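(* Let $(R,\mathfrak{m})$ be a local $F$-finite Gorenstein ring of prime characteristic $p$ and let $Q\subsetneq R$ be an ideal. Let $e>0$ and consider the following three conditions: (1) $\left(Q^{[p^e]}:Q\right)\nsubseteq I_e(\mathfrak{m})$. (2) $\left(I_e(Q):Q\right)\nsubseteq I_e(\mathfrak{m})$. (3) $R/Q$ is $F$-pure. Then $(1)\Rightarrow(2)\Rightarrow(3)$, and moreover $(3)\Rightarrow(1)$ if $\operatorname{pd}_R(R/Q)<\infty$.
   Context: All rings are commutative, Noetherian, with unity, of prime characteristic $p>0$. $F^e_*R$ denotes $R$ viewed as an $R$-module via the $e$-th iterate of Frobenius; its elements are written $F^e_*r$. $R$ is $F$-finite if $F^e_*R$ is a finite $R$-module. An $F$-finite ring $A$ is $F$-pure if the natural map $A\to F^e_*A$ splits as a map of $A$-modules for one (equivalently all) $e>0$. For an ideal $Q$, $Q^{[p^e]}$ is the ideal generated by the $p^e$-th powers of elements of $Q$, and $I_e(Q)=\{r\in R:\varphi(F^e_*r)\in Q\text{ for all }\varphi\in\operatorname{Hom}_R(F^e_*R,R)\}$. *)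

(* Defs.v *)
From HB Require Import structures.
From mathcomp Require Import all_boot all_algebra.
From mathcomp Require Import boolp classical_sets.

Set Implicit Arguments.
Unset Strict Implicit.
Unset Printing Implicit Defensive.

Import GRing.Theory.

Local Open Scope classical_set_scope.
Local Open Scope quotient_scope.
Local Open Scope ring_scope.

Section Ideals.
Variable R : comNzRingType.
Implicit Types I J : set R.

Definition is_ideal I : Prop :=
  I 0 /\ forall a x y, I x -> I y -> I (a * x + y).

Definition ideal_gen (S : set R) : set R := smallest is_ideal S.

(* the colon ideal (I : J) *)
Definition colon I J : set R := [set r | forall x, J x -> I (r * x)].

Definition maximal_ideal I : Prop :=
  [/\ is_ideal I, ~ I 1 &
      forall J, is_ideal J -> ~ J 1 -> I `<=` J -> J = I].

Definition noetherian : Prop :=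
  forall I, is_ideal I -> exists s : seq R, I = ideal_gen [set` s].

Definition local_ring (m : set R) : Prop :=
  maximal_ideal m /\ forall n, maximal_ideal n -> n = m.

End Ideals.

Section Modules.
Variable R : comNzRingType.

Definition finite_module (M : lmodType R) : Prop :=
  exists (n : nat) (g : 'I_n -> M),
    forall x : M, exists c : 'I_n -> R, x = \sum_(i < n) c i *: g i.

Definition exact_at (L M N : lmodType R) (f : {linear L -> M})
    (g : {linear M -> N}) : Prop :=
  forall y : M, g y = 0 <-> exists x : L, f x = y.

Definition injective_module (E : lmodType R) : Prop :=
  forall (A B : lmodType R) (i : {linear A -> B}) (f : {linear A -> E}),
    injective i -> exists h : {linear B -> E}, forall a, h (i a) = f a.

Definition projective_module (P : lmodType R) : Prop :=
  forall (A B : lmodType R) (q : {linear A -> B}) (f : {linear P -> B}),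
    (forall b, exists a, q a = b) ->
    exists h : {linear P -> A}, forall x, q (h x) = f x.

(* There is an exact sequence 0 -> M -> E 0 -> ... -> E n -> 0 with every
   E i injective; it is extended by zero modules beyond n. *)
Definition finite_inj_dim (M : lmodType R) : Prop :=
  exists (n : nat) (E : nat -> lmodType R) (eta : {linear M -> E 0%N})
         (d : forall i, {linear E i -> E i.+1}),
    [/\ injective eta,
        exact_at eta (d 0%N),
        forall i, exact_at (d i) (d i.+1),
        forall i, injective_module (E i) &
        forall i, (n < i)%N -> forall x : E i, x = 0].

(* There is an exact sequence 0 -> P n -> ... -> P 0 -> M -> 0 with every
   P i projective; it is extended by zero modules beyond n. *)
Definition finite_proj_dim (M : lmodType R) : Prop :=
  exists (n : nat) (P : nat -> lmodType R) (eps : {linear P 0%N -> M})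
         (d : forall i, {linear P i.+1 -> P i}),
    [/\ forall x, exists y, eps y = x,
        exact_at (d 0%N) eps,
        forall i, exact_at (d i.+1) (d i),
        forall i, projective_module (P i) &
        forall i, (n < i)%N -> forall x : P i, x = 0].

End Modules.

(* Only meaningful for Noetherian local R. *)
Definition gorenstein (R : comNzRingType) : Prop := finite_inj_dim (R^o).

(* The quotient ring R/Q, as an R-module by restriction of scalars. *)
Section QuotientModule.
Variables (R : comNzRingType) (Q : idealr R).

Definition quot_scale (a : R) (x : {ideal_quot Q}) : {ideal_quot Q} :=
  \pi_{ideal_quot Q} a * x.

Lemma quot_scaleA a b x :
  quot_scale a (quot_scale b x) = quot_scale (a * b) x.
Proof. by rewrite /quot_scale rmorphM mulrA. Qed.

Lemma quot_scale1 : left_id 1 quot_scale.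
Proof. by move=> x; rewrite /quot_scale rmorph1 mul1r. Qed.

Lemma quot_scaleDr : right_distributive quot_scale +%R.
Proof. by move=> a x y; rewrite /quot_scale mulrDr. Qed.

Lemma quot_scaleDl x : {morph quot_scale^~ x : a b / a + b}.
Proof. by move=> a b; rewrite /quot_scale rmorphD mulrDl. Qed.

HB.instance Definition _ := GRing.Zmodule_isLmodule.Build R {ideal_quot Q}
  quot_scaleA quot_scale1 quot_scaleDr quot_scaleDl.

Lemma pchar_quot (p : nat) : p \in [pchar R] -> p \in [pchar {ideal_quot Q}].
Proof. exact: (rmorph_pchar (\pi_{ideal_quot Q})). Qed.

End QuotientModule.

(* F^e_* R: the additive group R on which a acts as multiplication by
   a ^ (p ^ e). *)
Definition Fpush (R : comNzRingType) (p : nat) (charRp : p \in [pchar R])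
  (e : nat) : Type := R.

Section FrobeniusPushforward.
Variables (R : comNzRingType) (p : nat) (charRp : p \in [pchar R]) (e : nat).

HB.instance Definition _ := GRing.Zmodule.copy (Fpush charRp e) R.

Definition Felt (r : R) : Fpush charRp e := r.

Definition Fpush_scale (a : R) (x : Fpush charRp e) : Fpush charRp e :=
  Felt (a ^+ (p ^ e) * (x : R)).

Lemma Fpush_scaleA a b x :
  Fpush_scale a (Fpush_scale b x) = Fpush_scale (a * b) x.
Proof. by rewrite /Fpush_scale /Felt mulrA exprMn. Qed.

Lemma Fpush_scale1 : left_id 1 Fpush_scale.
Proof. by move=> x; rewrite /Fpush_scale /Felt expr1n mul1r. Qed.

Lemma Fpush_scaleDr : right_distributive Fpush_scale +%R.
Proof. by move=> a x y; exact: (mulrDr (a ^+ (p ^ e) : R)). Qed.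

Lemma Fpush_scaleDl x : {morph Fpush_scale^~ x : a b / a + b}.
Proof.
move=> a b; rewrite /Fpush_scale /Felt exprDn_pchar; first exact: mulrDl.
by rewrite pnatX orbC (pnatE _ (pcharf_prime charRp)) charRp orbT.
Qed.

HB.instance Definition _ := GRing.Zmodule_isLmodule.Build R (Fpush charRp e)
  Fpush_scaleA Fpush_scale1 Fpush_scaleDr Fpush_scaleDl.

(* the natural map R -> F^e_* R *)
Definition Fmap (a : R) : Fpush charRp e := Felt (a ^+ (p ^ e)).

(* Q^[p^e] *)
Definition frob_power (Q : set R) : set R :=
  ideal_gen [set x ^+ (p ^ e) | x in Q].

Definition I_ (Q : set R) : set R :=
  [set r | forall phi : {linear Fpush charRp e -> R^o}, Q (phi (Felt r))].

End FrobeniusPushforward.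

Definition F_finite (R : comNzRingType) (p : nat) (charRp : p \in [pchar R]) :
  Prop := exists2 e, (0 < e)%N & finite_module (Fpush charRp e).

Definition F_pure (A : comNzRingType) (p : nat) (charAp : p \in [pchar A]) :
  Prop := exists2 e, (0 < e)%N &
    exists phi : {linear Fpush charAp e -> A^o},
      forall a : A, phi (Fmap charAp e a) = a.

(* Main.v *)
Require Import Defs.
From HB Require Import structures.
From mathcomp Require Import all_boot all_algebra.
From mathcomp Require Import boolp classical_sets functions.
From mathcomp Require Import finmap monalg.

Set Implicit Arguments.
Unset Strict Implicit.
Unset Printing Implicit Defensive.

Import GRing.Theory.

Local Open Scope classical_set_scope.
Local Open Scope quotient_scope.
Local Open Scope ring_scope.

(** Write S for F^e_* R and q for p^e. That (1) implies (2) is the inclusion of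
    Q^[q] in I_e(Q). If r witnesses (2), some phi : S -> R has phi(r) a unit, and
    phi(r * _) maps Q to Q; divided by its value at 1 it induces a splitting of
    Frobenius on R/Q.

    For the converse let R/Q be F-pure of finite projective dimension. Two
    consequences of R being Gorenstein carry the argument.

    - S is maximal Cohen-Macaulay, so Ext^i(S, R) = 0 for i > 0 ([twist_ext0]).
      Therefore Hom(S, _) is exact on finite projective resolutions, every map
      S -> R/Q lifts to R, and every map S -> R with values in Q belongs to
      Q Hom(S, R) ([lift_quotient]).
    - Hom(S, R) is generated over S by a single map Phi ([frobenius_trace]).

    A splitting of Frobenius on R/Q thus lifts to psi : S -> R, and
    psi = Phi(r * _) for some r. As psi(1) is a unit, r is not in I_e(m). For x
    in Q the map psi(x * _) has values in Q, hence equals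
    sum_i z_i Phi(t_i * _) = Phi(sum_i z_i^q t_i * _) with the z_i in Q. It
    remains to cancel Phi: if t Phi = 0 then t psi = 0, whence
    0 = psi(t^q) = t psi(1) and t = 0. So r x is in Q^[q].

    Both facts about S come from the cohomology of Hom(M, E), for E a finite
    injective resolution of R and M finitely generated. A regular sequence xs of
    maximal length d exists because a regular sequence forces nonzero cohomology
    in some degree at or above its length. By maximality the residue field k
    embeds in R/xs, and descending induction gives Ext^i(M, R) = 0 for i > d
    ([max_regseq_van]). The powers xs^q again form a regular sequence, that is,
    xs is regular on S, and by Nakayama the vanishing climbs from S/xs S to S.

    For the cyclicity, Hom(S, R) has the finite injective resolution
    E' = Hom(S, E) over S, and the cohomology of Hom_S(M, E') is that of
    Hom_R(M, E) with M regarded as an R-module. Let B = R/xs^q. Connecting maps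
    show that Ext^d(B, R) is cyclic since Hom(R, R) is, so that Ext^d(k, R) is
    cyclic ([residue_cyc]) and the socle of B is a copy of k ([socle_unique]).
    Linear algebra over k transfers the first to E' ([coind_residue_cyc]);
    right exactness in degree d passes from k, the socle of B, to B
    ([cyc_of_socle]); and the same connecting maps with Nakayama go back from B
    to R, where the cohomology in degree 0 of E' is Hom(S, R). *)

(** * Linear maps, submodules and quotient modules *)

Section Linear.
Variable R : comNzRingType.
Implicit Types L M N : lmodType R.

(** A property of plain functions rather than a bundled map: most maps below
    are obtained by choice. *)
Definition lin M N (f : M -> N) : Prop :=
  forall a x y, f (a *: x + y) = a *: f x + f y.

Lemma linD M N (f : M -> N) x y : lin f -> f (x + y) = f x + f y.
Proof. by move=> hf; rewrite -[x in LHS]scale1r hf scale1r. Qed.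

Lemma lin0 M N (f : M -> N) : lin f -> f 0 = 0.
Proof. by move=> hf; apply: (addIr (f 0)); rewrite -linD // !add0r. Qed.

Lemma linZ M N (f : M -> N) a x : lin f -> f (a *: x) = a *: f x.
Proof. by move=> hf; rewrite -[a *: x]addr0 hf lin0 // addr0. Qed.

Lemma linN M N (f : M -> N) x : lin f -> f (- x) = - f x.
Proof. by move=> hf; rewrite -scaleN1r linZ // scaleN1r. Qed.

Lemma linB M N (f : M -> N) x y : lin f -> f (x - y) = f x - f y.
Proof. by move=> hf; rewrite linD // linN. Qed.

Lemma lin_inj M N (f : M -> N) : lin f -> (forall x, f x = 0 -> x = 0) ->
  injective f.
Proof.
move=> hf kf x y fxy; apply/eqP; rewrite -subr_eq0; apply/eqP/kf.
by rewrite linB // fxy subrr.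
Qed.

Lemma lin_sum M N (f : M -> N) (I : finType) (F : I -> M) :
  lin f -> f (\sum_i F i) = \sum_i f (F i).
Proof.
move=> hf; apply: (big_morph f) => [x y|]; [exact: linD | exact: lin0].
Qed.

Lemma lin_id M : lin (fun x : M => x). Proof. by []. Qed.

Lemma lin_cst0 M N : lin (fun _ : M => 0 : N).
Proof. by move=> a x y; rewrite scaler0 addr0. Qed.

Lemma lin_comp L M N (g : M -> N) (f : L -> M) :
  lin g -> lin f -> lin (fun x => g (f x)).
Proof. by move=> hg hf a x y; rewrite hf hg. Qed.

Lemma lin_add M N (f g : M -> N) :
  lin f -> lin g -> lin (fun x => f x + g x).
Proof. by move=> hf hg a x y; rewrite hf hg scalerDr addrACA. Qed.

Lemma lin_scale M N c (f : M -> N) : lin f -> lin (fun x => c *: f x).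
Proof. by move=> hf a x y; rewrite hf scalerDr !scalerA mulrC. Qed.

Lemma lin_sub M N (f g : M -> N) :
  lin f -> lin g -> lin (fun x => f x - g x).
Proof.
by move=> hf hg a x y; rewrite hf hg scalerBr opprD addrACA.
Qed.

Lemma lin_bigsum M N (I : finType) (f : I -> M -> N) :
  (forall i, lin (f i)) -> lin (fun x => \sum_i f i x).
Proof.
move=> hf a x y; rewrite scaler_sumr -big_split; apply: eq_bigr => i _.
exact: hf.
Qed.

Lemma linear_lin M N (f : {linear M -> N}) : lin f.
Proof. by move=> a x y; rewrite linearP. Qed.

Lemma lin_linear M N (f : M -> N) : lin f ->
  exists g : {linear M -> N}, forall x, g x = f x.
Proof.
move=> hf.
pose L := GRing.isLinear.Build R M N *:%R f hf.
by exists (HB.pack_for {linear M -> N} f L).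
Qed.

Definition submod M (K : set M) : Prop :=
  K 0 /\ forall a x y, K x -> K y -> K (a *: x + y).

Section SubmodTheory.
Variables (M : lmodType R) (K : set M).
Hypothesis hK : submod K.

Lemma submodD x y : K x -> K y -> K (x + y).
Proof. by move=> Kx Ky; rewrite -[x]scale1r; apply: hK.2. Qed.

Lemma submodZ a x : K x -> K (a *: x).
Proof. by move=> Kx; rewrite -[_ *: _]addr0; apply: hK.2 => //; case: hK. Qed.

Lemma submodN x : K x -> K (- x).
Proof. by move=> Kx; rewrite -scaleN1r; apply: submodZ. Qed.

Lemma submodB x y : K x -> K y -> K (x - y).
Proof. by move=> Kx Ky; apply: submodD => //; apply: submodN. Qed.

Lemma submod_sum (I : finType) (F : I -> M) :
  (forall i, K (F i)) -> K (\sum_i F i).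
Proof. by move=> KF; elim/big_ind: _ => //; [case: hK | exact: submodD]. Qed.

End SubmodTheory.

Lemma range_submod M N (f : M -> N) : lin f -> submod (range f).
Proof.
move=> hf; split=> [|a _ _ [x _ <-] [y _ <-]]; first by exists 0; rewrite ?lin0.
by exists (a *: x + y); rewrite ?hf.
Qed.

Section SubType.
Variables (M : lmodType R) (K : set M).
Hypothesis hK : submod K.

Record subm (h : submod K) := Subm {subm_val : M; _ : `[< K subm_val >]}.

HB.instance Definition _ := [isSub for @subm_val hK].
HB.instance Definition _ := [Choice of subm hK by <:].

Lemma subm_closed : GRing.subsemimod_closed (fun x => `[< K x >]).
Proof.
split; first split=> [|x y /asboolP Kx /asboolP Ky].
- by apply/asboolP; case: hK.
- by apply/asboolP; exact: submodD.
- by move=> a x /asboolP Kx; apply/asboolP; exact: submodZ.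
Qed.

HB.instance Definition _ := GRing.SubChoice_isSubLmodule.Build R M _ (subm hK)
  subm_closed.

End SubType.

(** Submodules and quotients are used through their universal maps only. *)
Lemma submodule_exists M (K : set M) : submod K ->
  exists (N : lmodType R) (i : N -> M),
    [/\ lin i, injective i & forall x, K x <-> exists y, i y = x].
Proof.
move=> hK; exists (subm hK : lmodType R), (@subm_val _ _ hK); split.
- by move=> a x y; exact: (linearP (val : subm hK -> M)).
- exact: val_inj.
- move=> x; split=> [Kx|[[y /= /asboolP Ky] <- //]].
  by exists (Subm hK (asboolT Kx)).
Qed.

Section QuotType.
Variables (M : lmodType R) (K : set M).
Hypothesis hK : submod K.

Definition submod_pred (h : submod K) : {pred M} := fun x => `[< K x >].

Lemma submod_zmod_closed : zmod_closed (submod_pred hK).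
Proof.
split=> [|x y /asboolP Kx /asboolP Ky]; apply/asboolP; first by case: hK.
exact: submodB.
Qed.

HB.instance Definition _ := GRing.isZmodClosed.Build M (submod_pred hK)
  submod_zmod_closed.

Definition quotm := Quotient.quot (submod_pred hK : zmodClosed M).

HB.instance Definition _ := GRing.Zmodule.on quotm.

Definition quotm_pi (x : M) : quotm :=
  \pi_(Quotient.quot (submod_pred hK : zmodClosed M)) x.

Lemma quotm_eq x y : quotm_pi x = quotm_pi y <-> K (x - y).
Proof.
split=> [/eqP|Kxy].
  by rewrite /quotm_pi -Quotient.idealrBE => /asboolP.
by apply/eqP; rewrite /quotm_pi -Quotient.idealrBE; apply/asboolP.
Qed.

Lemma quotm_surj x : exists y, quotm_pi y = x.
Proof. by exists (repr x); rewrite /quotm_pi reprK. Qed.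

Lemma quotm_piD x y : quotm_pi (x + y) = quotm_pi x + quotm_pi y.
Proof. exact: (raddfD (\pi_(Quotient.quot (submod_pred hK : zmodClosed M)))). Qed.

Definition quotm_scale a (x : quotm) : quotm := quotm_pi (a *: repr x).

Lemma quotm_scaleE a x : quotm_scale a (quotm_pi x) = quotm_pi (a *: x).
Proof.
apply/quotm_eq; rewrite -scalerBr; apply: submodZ => //; apply/quotm_eq.
by rewrite /quotm_pi reprK.
Qed.

Lemma quotm_scaleA a b x :
  quotm_scale a (quotm_scale b x) = quotm_scale (a * b) x.
Proof. by have [y <-] := quotm_surj x; rewrite !quotm_scaleE scalerA. Qed.

Lemma quotm_scale1 : left_id 1 quotm_scale.
Proof. by move=> x; have [y <-] := quotm_surj x; rewrite quotm_scaleE scale1r. Qed.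

Lemma quotm_scaleDr : right_distributive quotm_scale +%R.
Proof.
move=> a x y; have [u <-] := quotm_surj x; have [v <-] := quotm_surj y.
by rewrite -quotm_piD !quotm_scaleE scalerDr quotm_piD.
Qed.

Lemma quotm_scaleDl x : {morph quotm_scale^~ x : a b / a + b}.
Proof.
move=> a b; have [u <-] := quotm_surj x.
by rewrite !quotm_scaleE scalerDl quotm_piD.
Qed.

HB.instance Definition _ := GRing.Zmodule_isLmodule.Build R quotm
  quotm_scaleA quotm_scale1 quotm_scaleDr quotm_scaleDl.

Lemma quotm_lin : lin quotm_pi.
Proof. by move=> a x y; rewrite quotm_piD -quotm_scaleE. Qed.

End QuotType.

Definition is_quot M N (K : set M) (p : M -> N) : Prop :=
  [/\ lin p, forall y, exists x, p x = y & forall x, p x = 0 <-> K x].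

Lemma quotient_exists M (K : set M) : submod K ->
  exists (N : lmodType R) (p : M -> N), is_quot K p.
Proof.
move=> hK; exists (quotm hK : lmodType R), (@quotm_pi _ _ hK); split.
- exact: quotm_lin.
- exact: quotm_surj.
- move=> x; rewrite -(lin0 (@quotm_lin _ _ hK)) -[X in K X]subr0.
  exact: quotm_eq.
Qed.

Lemma quot_factor M N L (p : M -> N) (f : M -> L) :
  lin p -> (forall y, exists x, p x = y) -> lin f ->
  (forall x, p x = 0 -> f x = 0) ->
  exists2 g : N -> L, lin g & forall x, g (p x) = f x.
Proof.
move=> hp sp hf kf; pose s y := projT1 (cid (sp y)).
have ps y : p (s y) = y by rewrite /s; case: cid.
have fs x y : p x = p y -> f x = f y.
  move=> pxy; apply/eqP; rewrite -subr_eq0 -linB //; apply/eqP; apply: kf.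
  by rewrite linB // pxy subrr.
exists (fun y => f (s y)) => [a x y|x]; last by apply: fs; rewrite ps.
by rewrite -hf; apply: fs; rewrite hp !ps.
Qed.

(** A map defined on the image of [i] is extended by way of the submodule
    of all values of [i]. *)
Lemma injective_extend (E A B : lmodType R) (i : A -> B) (f : A -> E) :
  injective_module E -> lin i -> lin f ->
  (forall a, i a = 0 -> f a = 0) ->
  exists2 h : B -> E, lin h & forall a, h (i a) = f a.
Proof.
move=> injE hi hf kf.
have [I [j [hj injj Ij]]] := submodule_exists (range_submod hi).
have jP a : exists y, j y = i a by apply/Ij; exists a.
pose t a := projT1 (cid (jP a)).
have jt a : j (t a) = i a by rewrite /t; case: cid.
have [||||g hg gt] := @quot_factor A I E t f.
- by move=> a x y; apply: injj; rewrite hj !jt hi.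
- move=> y; have [x _ xy] := (Ij (j y)).2 (ex_intro _ y erefl).
  by exists x; apply: injj; rewrite jt.
- exact: hf.
- by move=> x tx; apply: kf; rewrite -jt tx lin0.
have [g' g'E] := lin_linear hg; have [j' j'E] := lin_linear hj.
have [|h hE] := injE _ _ j' g'; first by move=> x y; rewrite !j'E => /injj.
exists h => [|a]; first exact: linear_lin.
by rewrite -jt -j'E hE g'E gt.
Qed.

Lemma rV_gen n M (f : 'rV[R]_n -> M) v : lin f ->
  f v = \sum_i v 0 i *: f (delta_mx 0 i).
Proof.
move=> hf; rewrite {1}[v]row_sum_delta lin_sum //.
by apply: eq_bigr => i _; rewrite linZ.
Qed.

Lemma rV_map n M (g : 'I_n -> M) : lin (fun v : 'rV[R]_n => \sum_i v 0 i *: g i).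
Proof.
apply: lin_bigsum => i a x y.
by rewrite !mxE scalerDl scalerA.
Qed.

Lemma rV_lift n L N (p : L -> N) (f : 'rV[R]_n -> N) : lin p -> lin f ->
  (forall v, exists y, p y = f v) ->
  exists2 h : 'rV[R]_n -> L, lin h & forall v, p (h v) = f v.
Proof.
move=> hp hf pf; pose g i := projT1 (cid (pf (delta_mx 0 i))).
have pg i : p (g i) = f (delta_mx 0 i) by rewrite /g; case: cid.
exists (fun v => \sum_i v 0 i *: g i); first exact: rV_map.
move=> v; rewrite lin_sum // (rV_gen v hf).
by apply: eq_bigr => i _; rewrite linZ // pg.
Qed.

Lemma R_lift L N (p : L -> N) (f : R^o -> N) : lin p -> lin f ->
  (forall v, exists y, p y = f v) ->
  exists2 h : R^o -> L, lin h & forall v, p (h v) = f v.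
Proof.
move=> hp hf pf; have [y py] := pf 1.
exists (fun v : R^o => (v : R) *: y) => [a u v|v].
  by rewrite scalerDl scalerA.
by rewrite linZ // py -linZ //; congr f; exact: mulr1.
Qed.

End Linear.

(** * Noetherian and local rings *)

Section Finite.
Variable R : comNzRingType.
Implicit Types M N V : lmodType R.

Definition fgset V (Z : set V) : Prop :=
  exists (I : finType) (g : I -> V),
    (forall i, Z (g i)) /\ forall z, Z z -> exists c, z = \sum_i c i *: g i.

Definition fg M : Prop := fgset [set: M].

Lemma fgset_ord V (Z : set V) : fgset Z -> exists n (g : 'I_n -> V),
    (forall i, Z (g i)) /\ forall z, Z z -> exists c, z = \sum_i c i *: g i.
Proof.
case=> I [g [Zg gZ]]; exists #|I|, (fun i => g (enum_val i)); split=> // z /gZ.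
case=> c ->; exists (fun i => c (enum_val i)).
by rewrite (reindex (fun i : 'I_#|I| => enum_val i)) //; apply/onW_bij/enum_val_bij.
Qed.

Lemma fgset_image M N (f : M -> N) (Z : set M) : lin f -> fgset Z ->
  fgset (f @` Z).
Proof.
move=> hf [I [g [Zg gZ]]]; exists I, (fun i => f (g i)); split=> [i|_ [z /gZ[c ->] <-]].
  by exists (g i).
by exists c; rewrite lin_sum //; apply: eq_bigr => i _; rewrite linZ.
Qed.

Lemma fg_surj M N (f : M -> N) : lin f -> (forall y, exists x, f x = y) ->
  fg M -> fg N.
Proof.
move=> hf sf /(fgset_image hf)[I [g [_ gZ]]]; exists I, g; split=> // y _.
by apply: gZ; have [x <-] := sf y; exists x.
Qed.

Lemma fg_inj_range M N (f : M -> N) : lin f -> injective f ->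
  fgset (range f) -> fg M.
Proof.
move=> hf injf [I [g [rg gZ]]].
pose h i := projT1 (cid2 (rg i)).
have fh i : f (h i) = g i by rewrite /h; case: cid2.
exists I, h; split=> // x _; have [|c fx] := gZ (f x); first by exists x.
exists c; apply: injf; rewrite fx lin_sum //.
by apply: eq_bigr => i _; rewrite linZ // fh.
Qed.

Lemma fg_rV n : fg ('rV[R]_n : lmodType R).
Proof.
exists 'I_n, (fun i => delta_mx 0 i); split=> // z _.
by exists (fun i => z 0 i); rewrite {1}[z]row_sum_delta.
Qed.

Lemma fg_R : fg (R^o : lmodType R).
Proof.
exists 'I_1, (fun=> 1); split=> // z _; exists (fun=> z).
by rewrite big_ord1 [RHS]mulr1.
Qed.

Lemma fg_cover M : fg M ->
  exists n (p : 'rV[R]_n -> M), lin p /\ forall y, exists x, p x = y.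
Proof.
case/fgset_ord=> n [g [_ gM]]; exists n, (fun v : 'rV[R]_n => \sum_i v 0 i *: g i).
split=> [|y]; first exact: rV_map.
have [//|c ->] := gM y; exists (\row_i c i).
by apply: eq_bigr => i _; rewrite mxE.
Qed.

Lemma fgset_sum V n (g : 'I_n -> V) (Z1 Z : set V) : submod Z ->
  Z1 `<=` Z -> fgset Z1 -> (forall i, Z (g i)) ->
  (forall z, Z z -> exists c, Z1 (z - \sum_i c i *: g i)) -> fgset Z.
Proof.
move=> hZ Z1Z [I [h [Z1h hZ1]]] Zg gZ.
exists ('I_n + I)%type, (fun i => match i with inl j => g j | inr j => h j end).
split=> [[j|j]|z /gZ[c /hZ1[c' zE]]]; [exact: Zg | exact/Z1Z/Z1h |].
exists (fun i => match i with inl j => c j | inr j => c' j end).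
by rewrite big_sumType /= -zE addrC subrK.
Qed.

Lemma ideal_gen_seq (s : seq R) a : ideal_gen [set` s] a ->
  exists b : 'I_(size s) -> R, a = \sum_i b i * s`_i.
Proof.
move=> /(_ [set a | exists b : 'I_(size s) -> R, a = \sum_i b i * s`_i]); apply.
split=> [|x /= xs].
  split=> [|u _ _ [b ->] [c ->]].
    by exists (fun=> 0); rewrite big1 // => i _; rewrite mul0r.
  exists (fun i => u * b i + c i); rewrite mulr_sumr -big_split.
  by apply: eq_bigr => i _; rewrite mulrDl mulrA.
have xs' := xs; rewrite -index_mem in xs'.
exists (fun i => (i == Ordinal xs')%:R).
rewrite (bigD1 (Ordinal xs')) //= eqxx mul1r nth_index // big1 ?addr0 // => i.
by move=> /negPf->; rewrite mul0r.
Qed.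

Lemma ideal_gen_sub (S : set R) : S `<=` ideal_gen S.
Proof. exact: sub_smallest. Qed.

Lemma ideal_gen_ideal (S : set R) : is_ideal (ideal_gen S).
Proof.
split=> [I [[I0 _] _] //|a x y Ix Iy I hI].
by apply: hI.1.2; [apply: Ix | apply: Iy].
Qed.

Lemma ideal_gen_min (S I : set R) : is_ideal I -> S `<=` I ->
  ideal_gen S `<=` I.
Proof. by move=> hI SI x; apply. Qed.

Hypothesis noethR : noetherian R.

(** Induction on the number of generators: the coefficients at the first one
    form an ideal, and lifts of its generators reduce to the span of the others. *)
Lemma noeth_fgset V n (g : 'I_n -> V) (W : set V) : submod W ->
  (forall w, W w -> exists c, w = \sum_i c i *: g i) -> fgset W.
Proof.
elim: n g W => [|n IHn] g W hW gW.
  exists 'I_0, g; split=> [[]//|w /gW[c ->]].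
  by exists c; rewrite !big_ord0.
pose span c := \sum_(i < n) c i *: g (lift ord0 i).
pose W0 : set V := [set w | W w /\ exists c, w = span c].
pose I : set R := [set a | exists w, W w /\ exists c, w = a *: g ord0 + span c].
have spanP a b c : a *: span b + span c = span (fun i => a * b i + c i).
  rewrite scaler_sumr -big_split; apply: eq_bigr => i _.
  by rewrite scalerDl scalerA.
have hI : is_ideal I.
  split=> [|a x y [u [Wu [b uE]]] [v [Wv [c vE]]]].
    exists 0; split; first by case: hW.
    by exists (fun=> 0); rewrite /span big1 ?scale0r ?addr0 // => i _; rewrite scale0r.
  exists (a *: u + v); split; first exact: hW.2.
  exists (fun i => a * b i + c i).
  by rewrite -spanP scalerDl -scalerA uE vE scalerDr addrACA.
have hW0 : submod W0.
  split=> [|a x y [Wx [b xE]] [Wy [c yE]]].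
    split; first by case: hW.
    by exists (fun=> 0); rewrite /span big1 // => i _; rewrite scale0r.
  split; first exact: hW.2.
  by exists (fun i => a * b i + c i); rewrite xE yE spanP.
have [s Is] := noethR hI.
have Ij (j : 'I_(size s)) : I s`_j.
  by rewrite Is; apply: ideal_gen_sub; rewrite /= mem_nth.
pose w j := projT1 (cid (Ij j)).
have wP j : W (w j) /\ exists c, w j = s`_j *: g ord0 + span c.
  by rewrite /w; case: cid.
have W0W : W0 `<=` W by move=> z [].
have fW0 : fgset W0 by apply: (IHn (fun i => g (lift ord0 i))) => // z [].
apply: (fgset_sum (g := w) hW W0W fW0) => [j|z Wz]; first by case: (wP j).
have [c zE] := gW z Wz; rewrite big_ord_recl -/(span (fun i => c (lift ord0 i))) in zE.
have : I (c ord0) by exists z; split=> //; exists (fun i => c (lift ord0 i)).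
rewrite Is => /ideal_gen_seq[b cE].
exists b; split.
  apply: submodB => //; apply: submod_sum => // i; apply: submodZ => //.
  by case: (wP i).
pose e j := projT1 (cid (wP j).2).
have eE j : w j = s`_j *: g ord0 + span (e j) by rewrite /e; case: cid.
exists (fun i => - (\sum_j b j * e j i) + c (lift ord0 i)).
rewrite zE cE scaler_suml.
under [X in _ - X]eq_bigr => j _ do rewrite eE scalerDr scalerA.
rewrite big_split /= opprD addrACA subrr add0r addrC.
rewrite /span; under [RHS]eq_bigr => i _ do rewrite scalerDl.
rewrite big_split /=; congr (_ + _); apply/eqP; rewrite eqr_oppLR; apply/eqP.
under [in LHS]eq_bigr => j _ do rewrite scaler_sumr.
rewrite exchange_big /= -sumrN; apply: eq_bigr => i _.
rewrite scaleNr opprK scaler_suml; apply: eq_bigr => j _.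
by rewrite scalerA.
Qed.

Lemma noeth_submod V (W Z : set V) : fgset Z -> submod W -> W `<=` Z -> fgset W.
Proof.
case/fgset_ord=> n [g [_ gZ]] hW WZ; apply: (@noeth_fgset _ n g) => // w Ww.
by apply: gZ; apply: WZ.
Qed.

Lemma noeth_fg_inj M N (f : M -> N) : lin f -> injective f -> fg N -> fg M.
Proof.
move=> hf injf fgN; apply: (fg_inj_range hf injf).
by apply: (noeth_submod fgN) => //; exact: range_submod.
Qed.

(** Noetherian induction: without it there is a strictly increasing chain of
    ideals, whose union has no finite set of generators. *)
Lemma noeth_ind (P : set R -> Prop) :
  (forall I, is_ideal I ->
     (forall J, is_ideal J -> I `<=` J -> ~ (J `<=` I) -> P J) -> P I) ->
  forall I, is_ideal I -> P I.
Proof.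
move=> IH I0 hI0; apply: contrapT => nP.
pose T := {I : set R | is_ideal I /\ ~ P I}.
have next (t : T) : {u : T | sval t `<=` sval u /\ ~ (sval u `<=` sval t)}.
  apply: cid; apply: contrapT => no; case: t no => I [hI nPI] no; apply: (nPI).
  apply: IH => // J hJ IJ nJI; apply: contrapT => nPJ; apply: no.
  by exists (exist _ J (conj hJ nPJ)).
pose t0 : T := exist _ I0 (conj hI0 nP).
pose t k := iter k (fun u => sval (next u)) t0.
have tS k : sval (t k) `<=` sval (t k.+1) /\ ~ (sval (t k.+1) `<=` sval (t k)).
  by rewrite /t /=; case: (next _).
have tle k l : (k <= l)%N -> sval (t k) `<=` sval (t l).
  elim: l => [|l IHl]; first by rewrite leqn0 => /eqP->.
  rewrite leq_eqVlt ltnS => /predU1P[->//|/IHl kl].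
  exact: subset_trans kl (tS l).1.
pose U : set R := [set x | exists k, sval (t k) x].
have hU : is_ideal U.
  split=> [|a x y [k xk] [l yl]]; first by exists 0%N; exact: hI0.1.
  exists (maxn k l); case: (svalP (t (maxn k l))) => [[_ h] _]; apply: h.
    exact: tle (leq_maxl _ _) _ xk.
  exact: tle (leq_maxr _ _) _ yl.
have [s Us] := noethR hU.
have [k sk] : exists k, [set` s] `<=` sval (t k).
  have : [set` s] `<=` U by rewrite Us; exact: ideal_gen_sub.
  elim: s {Us} => [|x s IHs] sU; first by exists 0%N.
  have [|k sk] := IHs; first by move=> y ys; apply: sU; rewrite /= inE ys orbT.
  have [|l xl] := sU x; first by rewrite /= inE eqxx.
  exists (maxn k l) => y; rewrite /= inE => /predU1P[->|ys].
    exact: tle (leq_maxr _ _) _ xl.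
  exact: tle (leq_maxl _ _) _ (sk _ ys).
apply: (tS k).2; apply: (@subset_trans _ U); first by move=> x; exists k.+1.
by rewrite Us; apply: ideal_gen_min sk; case: (svalP (t k)) => [].
Qed.

Variable m : set R.
Hypothesis locR : local_ring m.

Lemma local_ideal : is_ideal m. Proof. by case: locR => [[]]. Qed.
Lemma local_n1 : ~ m 1. Proof. by case: locR => [[]]. Qed.

(** The existence of maximal ideals, by Noetherian induction. *)
Lemma proper_sub_local (I : set R) : is_ideal I -> ~ I 1 -> I `<=` m.
Proof.
move: I; apply: noeth_ind => I hI IH nI1.
have [[J [hJ IJ nJI nJ1]]|no] := pselect (exists J,
    [/\ is_ideal J, I `<=` J, ~ (J `<=` I) & ~ J 1]).
  exact: subset_trans IJ (IH J hJ IJ nJI nJ1).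
suff <- : I = m by [].
apply: locR.2; split=> // J hJ nJ1 IJ; apply/seteqP; split=> //.
by apply: contrapT => nJI; apply: no; exists J.
Qed.

Lemma local_unit a : ~ m a -> exists b, b * a = 1.
Proof.
move=> nma; apply: contrapT => no; apply: nma.
apply: (proper_sub_local (I := [set x | exists b, x = b * a])).
- split=> [|u _ _ [b ->] [c ->]]; first by exists 0; rewrite mul0r.
  by exists (u * b + c); rewrite mulrDl mulrA.
- by case=> b b1; apply: no; exists b.
- by exists 1; rewrite mul1r.
Qed.

Lemma ideal_submod (I : set R) : is_ideal I -> @submod R R^o I.
Proof. by []. Qed.

Lemma local_unit1B a : m a -> exists b, b * (1 - a) = 1.
Proof.
move=> ma; apply: local_unit => mB; apply: local_n1.
by rewrite -(subrK a 1); apply: (submodD (ideal_submod local_ideal)).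
Qed.

(** Stated for a subquotient Z/N of a module, as cohomology is one; a generator
    is a combination of the others modulo N because 1 - a is a unit for a in m. *)
Theorem nakayama V (Z N : set V) (I : finType) (g : I -> V) :
  submod N -> (forall i, Z (g i)) ->
  (forall z, Z z -> exists c, N (z - \sum_i c i *: g i)) ->
  (forall z, Z z -> exists (J : finType) (s : J -> R) (w : J -> V),
     [/\ forall j, m (s j), forall j, Z (w j) & N (z - \sum_j s j *: w j)]) ->
  Z `<=` N.
Proof.
move=> hN Zg gZ hm.
have [n [g' [{}Zg {}gZ]]] : exists n (g : 'I_n -> V), (forall i, Z (g i)) /\
    forall z, Z z -> exists c, N (z - \sum_i c i *: g i).
  exists #|I|, (fun i => g (enum_val i)); split=> // z /gZ.
  case=> c; rewrite (reindex (fun i : 'I_#|I| => enum_val i)); last exact/onW_bij/enum_val_bij.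
  by exists (fun i => c (enum_val i)).
elim: n g' Zg gZ => [|n IHn] g' Zg gZ z Zz.
  by have [c] := gZ z Zz; rewrite big_ord0 subr0.
have [J [s [w [ms Zw gN]]]] := hm _ (Zg ord0).
pose c j := projT1 (cid (gZ _ (Zw j))).
have cN j : N (w j - \sum_i c j i *: g' i) by rewrite /c; case: cid.
pose a i := \sum_j s j * c j i.
have ma i : m (a i).
  apply: (submod_sum (ideal_submod local_ideal)) => j; rewrite mulrC.
  exact: (submodZ (ideal_submod local_ideal)).
have {}gN : N (g' ord0 - \sum_i a i *: g' i).
  have := submodD hN gN (submod_sum hN (fun j => submodZ hN (s j) (cN j))).
  congr N; rewrite -addrA; congr (_ + _).
  under [X in _ + X = _]eq_bigr => j _ do rewrite scalerBr.
  rewrite sumrB addrA addNr add0r; congr (- _).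
  under eq_bigr => j _ do rewrite scaler_sumr.
  rewrite exchange_big; apply: eq_bigr => i _.
  by rewrite scaler_suml; apply: eq_bigr => j _; rewrite scalerA.
have [u u1] := local_unit1B (ma ord0).
have {}gN : N (g' ord0 - \sum_i (u * a (lift ord0 i)) *: g' (lift ord0 i)).
  have := submodZ hN u gN; congr N.
  rewrite big_ord_recl opprD addrA -[X in X - _ - _]scale1r -scalerBl.
  rewrite scalerBr scalerA u1 scale1r scaler_sumr; congr (_ - _).
  by apply: eq_bigr => i _; rewrite scalerA.
apply: (IHn (fun i => g' (lift ord0 i))) => // {Zz}z Zz.
have [e] := gZ z Zz; rewrite big_ord_recl => zN.
exists (fun i => e (lift ord0 i) + e ord0 * (u * a (lift ord0 i))).
have := submodD hN zN (submodZ hN (e ord0) gN); congr N.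
rewrite scalerBr scaler_sumr opprD -!addrA; congr (z + _).
rewrite addrCA [- (e ord0 *: _) + _]addrA addNr add0r -opprD -big_split.
by congr (- _); apply: eq_bigr => i _; rewrite scalerDl scalerA.
Qed.

End Finite.

(** * Cohomology of maps into an injective complex *)

(** A finite injective resolution of the finitely generated module
    [ker d_0], which is not named. *)
Record icomplex (R : comNzRingType) := ICx {
  ic_mod :> nat -> lmodType R;
  ic_d : forall i, ic_mod i -> ic_mod i.+1;
  ic_lin : forall i, lin (@ic_d i);
  ic_dd : forall i x, ic_d (@ic_d i x) = 0;
  ic_inj : forall i, injective_module (ic_mod i);
  ic_exact : forall i (y : ic_mod i.+1), ic_d y = 0 -> exists x, ic_d x = y;
  ic_bound : exists n, forall i, (n < i)%N -> forall x : ic_mod i, x = 0;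
  ic_fg : fgset [set x : ic_mod 0%N | ic_d x = 0]
}.

Section Cohomology.
Variables (R : comNzRingType) (E : icomplex R).
Implicit Types (i : nat) (A B C L M N : lmodType R).
Local Notation d := (ic_d (i := E)).

Definition coc M i (g : M -> E i) : Prop :=
  lin g /\ forall v, ic_d (g v) = 0.

(** With [coc], this gives Ext^i(M, ker d_0) as the cocycles modulo the
    coboundaries; those of degree zero vanish. *)
Definition cob M i : (M -> E i) -> Prop :=
  match i return (M -> E i) -> Prop with
  | 0%N => fun g => forall v, g v = 0
  | j.+1 => fun g => exists2 h : M -> E j, lin h & forall v, g v = ic_d (h v)
  end.

Definition ext0 i M : Prop := forall g : M -> E i, coc g -> cob g.

Definition cyc i M : Prop := exists lam : M -> E i,
  coc lam /\ forall g, coc g -> exists a, cob (fun v => g v - a *: lam v).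

Lemma cob_eq M i (g g' : M -> E i) : g =1 g' -> cob g -> cob g'.
Proof. by move=> /funext->. Qed.

Lemma cob_coc M i (g : M -> E i) : cob g -> coc g.
Proof.
case: i g => [|i] g /= hg.
  split=> [a x y|v]; first by rewrite !hg scaler0 addr0.
  by rewrite hg; apply/lin0/ic_lin.
case: hg => h hh hg; split=> [a x y|v]; last by rewrite hg ic_dd.
by rewrite !hg hh ic_lin.
Qed.

Lemma coc_submod M i : submod (@coc M i).
Proof.
split=> [|a f g [hf df] [hg dg]].
  by split=> [|v]; [exact: lin_cst0 | apply/lin0/ic_lin].
split=> [|v]; first exact: lin_add (lin_scale _ hf) hg.
by rewrite [(_ + _) v]/(_ + _) ic_lin df dg scaler0 addr0.
Qed.

Lemma cob_submod M i : submod (@cob M i).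
Proof.
case: i => [|i] /=.
  split=> [//|a f g hf hg v].
  by rewrite (_ : (a *: f + g) v = a *: f v + g v) // hf hg scaler0 addr0.
split=> [|a f g [f' hf' hf] [g' hg' hg]].
  by exists (fun=> 0) => [|v]; [exact: lin_cst0 | rewrite lin0 //; exact: ic_lin].
exists (fun v => a *: f' v + g' v); first exact: lin_add (lin_scale _ hf') hg'.
by move=> v; rewrite ic_lin -hf -hg.
Qed.

Lemma cobD M i (f g : M -> E i) : cob f -> cob g -> cob (fun v => f v + g v).
Proof. exact: (submodD (@cob_submod M i)). Qed.

Lemma cobZ M i a (f : M -> E i) : cob f -> cob (fun v => a *: f v).
Proof. exact: (submodZ (@cob_submod M i)). Qed.

Lemma cocB M i (f g : M -> E i) : coc f -> coc g -> coc (fun v => f v - g v).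
Proof. exact: (submodB (@coc_submod M i)). Qed.

Lemma cocZ M i a (f : M -> E i) : coc f -> coc (fun v => a *: f v).
Proof. exact: (submodZ (@coc_submod M i)). Qed.

Lemma coc_comp L M i (f : L -> M) (g : M -> E i) :
  lin f -> coc g -> coc (fun v => g (f v)).
Proof. by move=> hf [hg dg]; split=> [|v //]; exact: lin_comp. Qed.

Lemma cob_comp L M i (f : L -> M) (g : M -> E i) :
  lin f -> cob g -> cob (fun v => g (f v)).
Proof.
case: i g => [|i] g hf /= => [hg v|[h hh hg]]; first exact: hg.
by exists (fun v => h (f v)) => [|v //]; exact: lin_comp.
Qed.

(** Hom(_, E) turns injections into surjections, also on coboundaries. *)
Lemma cob_extend A B i (f : A -> B) (g : A -> E i) :
  lin f -> injective f -> cob g ->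
  exists2 b : B -> E i, cob b & forall v, b (f v) = g v.
Proof.
case: i g => [|i] g hf injf /= => [hg|[h hh hg]].
  by exists (fun=> 0) => // v; rewrite hg.
have [|k hk kE] := injective_extend (ic_inj (i:=i)) hf hh.
  by move=> a fa; rewrite -(lin0 hh); congr h; apply: injf; rewrite fa lin0.
exists (fun v => ic_d (k v)); first by exists k.
by move=> v; rewrite kE hg.
Qed.

(** Exactness of Ext^i(B) -> Ext^i(A) -> Ext^{i+1}(C): an extension of [g] to B
    has a differential that factors through C, where it bounds. *)
Lemma coc_extend A B C i (f : A -> B) (p : B -> C) (g : A -> E i) :
  lin f -> is_quot (range f) p -> ext0 i.+1 C -> coc g ->
  (forall a, f a = 0 -> g a = 0) ->
  exists2 g' : B -> E i, coc g' & forall v, g' (f v) = g v.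
Proof.
move=> hf [hp sp kp] extC [hg dg] kg.
have [G hG GE] := injective_extend (ic_inj (i:=i)) hf hg kg.
have [||g'' hg'' g''E] := @quot_factor _ _ _ _ p (fun v => ic_d (G v)) hp sp.
- by apply: lin_comp hG; exact: ic_lin.
- by move=> x /kp[a _ <-]; rewrite GE dg.
have [|h hh hE] := extC g''.
  by split=> // y; have [x <-] := sp y; rewrite g''E ic_dd.
exists (fun v => G v - h (p v)).
  split=> [|v]; first by apply: lin_sub hG (lin_comp hh hp).
  rewrite linB; last exact: ic_lin.
  by rewrite -g''E hE subrr.
move=> v; have pfv : p (f v) = 0 by apply/kp; exists v.
by rewrite GE pfv lin0 ?subr0.
Qed.

Lemma ext0_mid A B C i (f : A -> B) (p : B -> C) :
  lin f -> injective f -> is_quot (range f) p ->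
  ext0 i A -> ext0 i C -> ext0 i B.
Proof.
move=> hf injf [hp sp kp] extA extC g cg.
have [b cb bE] := cob_extend hf injf (extA _ (coc_comp hf cg)).
have [hgb dgb] := cocB cg (cob_coc cb).
have [|h hh hE] := quot_factor hp sp hgb.
  by move=> x /kp[a _ <-]; rewrite bE subrr.
have ch : coc h by split=> // y; have [x <-] := sp y; rewrite hE.
apply: cob_eq (cobD (cob_comp hp (extC _ ch)) cb) => v.
by rewrite hE subrK.
Qed.

Lemma ext0_left A B C i (f : A -> B) (p : B -> C) :
  lin f -> injective f -> is_quot (range f) p ->
  ext0 i B -> ext0 i.+1 C -> ext0 i A.
Proof.
move=> hf injf qp extB extC g cg.
have [|g' cg' g'E] := coc_extend hf qp extC cg.
  by move=> a fa; rewrite -(lin0 cg.1); congr g; apply: injf; rewrite fa lin0.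
exact: cob_eq g'E (cob_comp hf (extB _ cg')).
Qed.

Lemma ext0_rV n i : ext0 i.+1 ('rV[R]_n : lmodType R).
Proof.
move=> g [hg dg].
have [|h hh hE] := rV_lift (@ic_lin _ E i) hg; first by move=> v; exact: ic_exact.
by exists h.
Qed.

Lemma ext0_R i : ext0 i.+1 (R^o : lmodType R).
Proof.
move=> g [hg dg].
have [|h hh hE] := R_lift (@ic_lin _ E i) hg; first by move=> v; exact: ic_exact.
by exists h.
Qed.

Lemma ext0_bound : exists n, forall i, (n < i)%N -> forall M, ext0 i M.
Proof.
have [n bn] := ic_bound E; exists n => [[//|i] ni M g _].
by exists (fun=> 0) => [|v]; [exact: lin_cst0 | rewrite (bn _ ni (g v)) (bn _ ni (ic_d _))].
Qed.

Lemma ext0_zero M i : (forall v : M, v = 0) -> ext0 i M.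
Proof.
move=> M0 g [hg _]; apply: (cob_eq _ (cob_submod M i).1) => v.
by rewrite (M0 v) (lin0 hg).
Qed.

Section Regular.
Variables (x : R) (N N' : lmodType R) (p : N -> N').
Hypothesis regx : forall v : N, x *: v = 0 -> v = 0.
Hypothesis qp : is_quot [set z | exists v : N, z = x *: v] p.

Lemma mulx_lin : lin (fun v : N => x *: v).
Proof. exact: lin_scale (@lin_id _ _). Qed.

Lemma quotx v : p (x *: v) = 0.
Proof. by case: qp => _ _ kp; apply/kp; exists v. Qed.

Lemma lin_divx i (g : N -> E i) : lin g ->
  exists2 h : N -> E i, lin h & forall v, g v = x *: h v.
Proof.
move=> hg; have [|h hh hE] := injective_extend (ic_inj (i:=i)) mulx_lin hg.
  by move=> a /regx->; rewrite lin0.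
by exists h => // v; rewrite -hE linZ.
Qed.

(** The connecting map for 0 -> N -> N -> N' -> 0 sends the class of [g] to
    that of [g']. *)
Lemma coc_divx i (g : N -> E i) : coc g ->
  exists (h : N -> E i) (g' : N' -> E i.+1),
    [/\ lin h, forall v, g v = x *: h v, coc g' & forall v, ic_d (h v) = g' (p v)].
Proof.
move=> [hg dg]; have [h hh hE] := lin_divx hg.
have [hp sp kp] := qp.
have [|z|g' hg' g'E] := @quot_factor _ _ _ _ p (fun v => ic_d (h v)) hp sp.
- by apply: lin_comp hh; exact: ic_lin.
- by move=> /kp[v ->]; rewrite linZ // -hE dg.
exists h, g'; split=> //; split=> // y.
by have [v <-] := sp y; rewrite g'E ic_dd.
Qed.

Lemma cob_divx i (g : N -> E i) : cob g ->
  exists2 b : N -> E i, cob b & forall v, g v = x *: b v.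
Proof.
case: i g => [|i] g /= => [hg|[h hh hg]].
  by exists (fun=> 0) => // v; rewrite scaler0.
have [k hk kE] := lin_divx hh.
exists (fun v => ic_d (k v)); first by exists k.
by move=> v; rewrite hg kE linZ //; exact: ic_lin.
Qed.

(** The connecting map is surjective when Ext^{i+1}(N) = 0, a preimage of [g']
    being [x] times a lift of [g' \o p] along the differential. *)
Lemma coc_liftx i (g' : N' -> E i.+1) : coc g' -> ext0 i.+1 N ->
  exists k : N -> E i,
    [/\ lin k, forall v, ic_d (k v) = g' (p v) & coc (fun v => x *: k v)].
Proof.
move=> [hg' dg'] extN; have [hp sp kp] := qp.
have [k hk kE] := extN _ (coc_comp hp (conj hg' dg')).
exists k; split=> //; split=> [|v]; first exact: lin_scale.
rewrite linZ; last exact: ic_lin.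
by rewrite -kE -linZ // -linZ // quotx lin0.
Qed.

Lemma quotx_factor i (k : N -> E i) : lin k -> (forall v, x *: k v = 0) ->
  exists2 u : N' -> E i, lin u & forall v, u (p v) = k v.
Proof.
have [hp sp kp] := qp => hk xk.
by apply: quot_factor => // z /kp[v ->]; rewrite linZ.
Qed.

Lemma ext0_up i : ext0 i N -> ext0 i.+1 N -> ext0 i.+1 N'.
Proof.
move=> extN extN1 g' cg'; have [hp sp kp] := qp.
have [k [hk kE ck]] := coc_liftx cg' extN1.
have [b cb bE] := cob_divx (extN _ ck).
have [hb db] := cob_coc cb.
have [|v|u hu uE] := @quotx_factor i (fun v => k v - b v).
- exact: lin_sub.
- by rewrite scalerBr bE subrr.
exists u => // y; have [v <-] := sp y.
by rewrite uE linB ?db ?subr0 ?kE //; exact: ic_lin.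
Qed.

(** If the cohomology of [N] is cyclic then so is that of [N/xN] in the next
    degree, the connecting map being surjective. *)
Lemma cyc_up i : cyc i N -> ext0 i.+1 N -> cyc i.+1 N'.
Proof.
move=> [lam [clam hlam]] extN1; have [hp sp kp] := qp.
have [l [lam' [hl lE clam' l'E]]] := coc_divx clam.
exists lam'; split=> // g' cg'.
have [k [hk kE ck]] := coc_liftx cg' extN1.
have [a ca] := hlam _ ck; exists a.
have [b cb bE] := cob_divx ca; have [hb db] := cob_coc cb.
have [||u hu uE] := @quotx_factor i (fun v => k v - a *: l v - b v).
- by apply: lin_sub => //; apply: lin_sub => //; exact: lin_scale.
- move=> v; rewrite !scalerBr -bE lE scalerA mulrC -scalerA.
  by rewrite -[X in X - _]/(_ - _) subrr.
exists u => // y; have [v <-] := sp y.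
have hd := @ic_lin _ E i.
by rewrite uE !(linB _ _ hd) db subr0 (linZ _ _ hd) kE l'E.
Qed.

End Regular.

End Cohomology.

(** * Finiteness of cohomology *)

Section FiniteCohomology.
Variables (R : comNzRingType) (E : icomplex R) (m : set R).
Implicit Types (A B C L M N : lmodType R).
Hypotheses (noethR : noetherian R) (locR : local_ring m).

Lemma fct_sumZ (T : Type) N (I : finType) (c : I -> R) (G : I -> T -> N) :
  \sum_i c i *: G i = (fun v => \sum_i c i *: G i v).
Proof. by apply/funext => v; rewrite fct_sumE. Qed.

Lemma fgset_pow n M (Z : set M) : Z 0 -> fgset Z ->
  @fgset _ ('I_n -> M) [set w | forall k, Z (w k)].
Proof.
move=> Z0 [J [z [Zz zP]]].
exists ('I_n * J)%type, (fun ij k => if k == ij.1 then z ij.2 else 0).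
split=> [[i j] k /=|w Zw]; first by case: ifP.
pose c k := projT1 (cid (zP _ (Zw k))).
have wE k : w k = \sum_j c k j *: z j by rewrite /c; case: cid.
exists (fun ij => c ij.1 ij.2); apply/funext => k.
rewrite fct_sumZ wE -(pair_bigA _ (fun a b => c a b *: (if k == a then z b else 0))) /=.
rewrite (bigD1 k) //= eqxx [X in _ + X]big1 ?addr0 // => i /negPf ik.
by rewrite big1 // => j _; rewrite eq_sym ik scaler0.
Qed.

Lemma kernel_exists M N (p : M -> N) : lin p ->
  exists (K : lmodType R) (k : K -> M),
    [/\ lin k, injective k & forall v, p v = 0 <-> exists y, k y = v].
Proof.
move=> hp; have [|K [k [hk injk kP]]] := @submodule_exists _ M [set v | p v = 0].
  split=> [|a x y /= px py]; first exact: lin0.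
  by rewrite hp px py scaler0 addr0.
by exists K, k; split.
Qed.

Lemma is_quot_ker M N (p : M -> N) K (k : K -> M) : lin p ->
  (forall y, exists x, p x = y) ->
  (forall v, p v = 0 <-> exists y, k y = v) -> is_quot (range k) p.
Proof.
move=> hp sp kp; split=> // v; split=> [/kp[y ky]|[y _ ky]]; first by exists y.
by apply/kp; exists y.
Qed.

(** Hom(M, ker d_0) embeds into a finite power of [ker d_0], evaluating at
    generators of M. *)
Lemma ext_fg0 M : fg M ->
  exists (I : finType) (G : I -> M -> E 0%N), (forall j, coc (G j)) /\
    forall g, coc g -> exists c, cob (fun v => g v - \sum_j c j *: G j v).
Proof.
move=> /fg_cover[n [p [hp sp]]].
pose V : lmodType R := 'I_n -> E 0%N.
pose Z1 : set V := [set w | forall k, ic_d (w k) = 0].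
have fZ1 : fgset Z1.
  by apply: fgset_pow (ic_fg E); apply/lin0/ic_lin.
pose W : set V := [set w | exists2 g, @coc _ E M 0 g & w = fun k => g (p (delta_mx 0 k))].
have hW : submod W.
  split=> [|a _ _ [f cf ->] [g cg ->]].
    by exists (fun=> 0) => //; exact: (coc_submod E M 0).1.
  exists (a *: f + g) => //.
  exact: (coc_submod E M 0).2.
have [|I [w [Ww wP]]] := noeth_submod noethR fZ1 hW.
  by move=> w [g [_ dg] ->] k; exact: dg.
pose G i := projT1 (cid2 (Ww i)).
have [cG GE] : (forall i, coc (G i)) /\
    forall i, w i = fun k => G i (p (delta_mx 0 k)).
  by split=> i; rewrite /G; case: cid2.
exists I, G; split=> // g cg.
have [|c cE] := wP (fun k => g (p (delta_mx 0 k))); first by exists g.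
exists c => v; have [u <-] := sp v.
have hG i : lin (fun x => G i (p x)) by apply: lin_comp hp; case: (cG i).
rewrite (rV_gen u (lin_comp cg.1 hp)); apply/eqP; rewrite subr_eq0; apply/eqP.
under [RHS]eq_bigr => i _ do rewrite (rV_gen u (hG i)) scaler_sumr.
rewrite exchange_big; apply: eq_bigr => k _.
move/(congr1 (fun h => h k)): cE; rewrite fct_sumZ => ->.
rewrite scaler_sumr; apply: eq_bigr => i _.
by rewrite GE !scalerA mulrC.
Qed.

(** The cohomology of a finitely generated module is finitely generated: in
    degree [i.+1] it is a quotient of that of a syzygy in degree [i]. *)
Lemma ext_fg (i : nat) M : fg M ->
  exists (I : finType) (G : I -> M -> E i), (forall j, coc (G j)) /\
    forall g, coc g -> exists c, cob (fun v => g v - \sum_j c j *: G j v).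
Proof.
elim: i M => [|i IHi] M fgM; first exact: ext_fg0.
have [n [p [hp sp]]] := fg_cover fgM.
have [K [k [hk injk kp]]] := kernel_exists hp.
have [J [G [cG GP]]] := IHi K (noeth_fg_inj noethR hk injk (fg_rV R n)).
have pk y : p (k y) = 0 by apply/kp; exists y.
have hd := @ic_lin _ E.
have k0 y : k y = 0 -> y = 0 by move=> ky; apply: injk; rewrite ky lin0.
have ext j : exists GH : ('rV[R]_n -> E i) * (M -> E i.+1),
   [/\ lin GH.1, forall y, GH.1 (k y) = G j y, coc GH.2 &
       forall v, GH.2 (p v) = ic_d (GH.1 v)].
  have [hG dG] := cG j.
  have [|G' hG' G'E] := injective_extend (ic_inj (i:=i)) hk hG.
    by move=> y /k0->; rewrite lin0.
  have [||H hH HE] := @quot_factor _ _ _ _ p (fun v => ic_d (G' v)) hp sp.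
  - exact: lin_comp (hd i) hG'.
  - by move=> v /kp[y <-]; rewrite G'E dG.
  exists (G', H); split=> //; split=> // y.
  by have [v <-] := sp y; rewrite /= HE ic_dd.
pose GH j := projT1 (cid (ext j)).
have GHP j : [/\ lin (GH j).1, forall y, (GH j).1 (k y) = G j y, coc (GH j).2 &
       forall v, (GH j).2 (p v) = ic_d ((GH j).1 v)] by rewrite /GH; case: cid.
exists J, (fun j => (GH j).2); split=> [j|g [hg dg]]; first by case: (GHP j).
have [h hh hE] := @ext0_rV _ E n i _ (coc_comp hp (conj hg dg)).
have ch : coc (fun y => h (k y)).
  split=> [|y]; first exact: lin_comp.
  by rewrite -hE pk lin0.
have [c cc] := GP _ ch; exists c.
have [b cb bE] := cob_extend hk injk cc; have [hb db] := cob_coc cb.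
have hsum : lin (fun v => \sum_j c j *: (GH j).1 v).
  by apply: lin_bigsum => j; apply: lin_scale; case: (GHP j).
have [|v|u hu uE] := @quot_factor _ _ _ _ p
    (fun v => h v - \sum_j c j *: (GH j).1 v - b v) hp sp.
- by apply: lin_sub hb; exact: lin_sub.
- case/kp=> y <-; rewrite bE.
  under eq_bigr => j _ do [have [_ -> _ _] := GHP j].
  by rewrite subrr.
exists u => // y; have [v <-] := sp y.
rewrite uE !(linB _ _ (hd i)) db subr0 -hE; congr (_ - _).
rewrite (lin_sum _ (hd i)); apply: eq_bigr => j _.
by rewrite (linZ _ _ (hd i)); have [_ _ _ ->] := GHP j.
Qed.

Lemma ext_nakayama (i : nat) M (N : set (M -> E i)) : fg M -> submod N ->
  (forall g, cob g -> N g) ->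
  (forall g, coc g -> exists (J : finType) (s : J -> R) (w : J -> M -> E i),
     [/\ forall j, m (s j), forall j, coc (w j) &
         N (fun v => g v - \sum_j s j *: w j v)]) ->
  forall g, coc g -> N g.
Proof.
move=> fgM hN cN hm; have [I [G [cG GP]]] := ext_fg i fgM.
apply: (nakayama noethR locR hN cG) => [g /GP[c cg]|g /hm[J [s [w [ms cw Nw]]]]].
  by exists c; rewrite fct_sumZ; exact: cN.
by exists J, s, w; split=> //; rewrite fct_sumZ.
Qed.

Lemma cyc_submod i M (lam : M -> E i) :
  submod [set g : M -> E i | exists a, cob (fun v => g v - a *: lam v)].
Proof.
split=> [|a f h [b cf] [c ch]].
  exists 0; apply: (cob_eq _ (@cob_submod _ E M i).1) => v.
  by rewrite scale0r subr0.
exists (a * b + c); apply: cob_eq (cobD (cobZ a cf) ch) => v.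
by rewrite scalerBr [a *: (b *: _)]scalerA addrACA -opprD -scalerDl.
Qed.

(** A single cocycle generates the cohomology as soon as it does so modulo m. *)
Lemma cyc_nakayama i M (lam : M -> E i) : fg M -> coc lam ->
  (forall g : M -> E i, coc g ->
     exists a (J : finType) (s : J -> R) (w : J -> M -> E i),
     [/\ forall j, m (s j), forall j, coc (w j) &
         cob (fun v => g v - \sum_j s j *: w j v - a *: lam v)]) ->
  cyc E i M.
Proof.
move=> fgM clam h; exists lam; split=> // g.
apply: (ext_nakayama fgM (cyc_submod lam)) => [f cf|{}g /h[a [J [s [w [ms cw c]]]]]].
  by exists 0; apply: cob_eq cf => v; rewrite scale0r subr0.
by exists J, s, w; split=> //; exists a.
Qed.

Section Regular.
Variables (x : R) (N N' : lmodType R) (p : N -> N').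
Hypothesis regx : forall v : N, x *: v = 0 -> v = 0.
Hypothesis qp : is_quot [set z | exists v : N, z = x *: v] p.
Hypotheses (mx : m x) (fgN : fg N).

(** The exact sequence Ext^i(N) -> Ext^i(N) -> Ext^{i+1}(N') makes
    multiplication by [x] surjective, and Nakayama applies. *)
Lemma ext0_down i : ext0 E i.+1 N' -> ext0 E i N.
Proof.
move=> extN'; apply: (ext_nakayama fgN (@cob_submod _ E N i)) => // g cg.
have [hp _ _] := qp.
have [h [g' [hh hE cg' g'E]]] := coc_divx regx qp cg.
have [u hu uE] := extN' _ cg'.
have hd := @ic_lin _ E.
exists 'I_1, (fun=> x), (fun=> fun v => h v - u (p v)); split=> // [_|].
  split=> [|v]; first exact: lin_sub hh (lin_comp hu hp).
  by rewrite linB // g'E uE subrr.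
apply: (cob_eq _ (@cob_submod _ E N i).1) => v.
rewrite big_ord1 scalerBr -hE -(linZ _ _ hu) -(linZ _ _ hp) (quotx qp).
by rewrite (lin0 hu) subr0 subrr.
Qed.

(** Modulo [x] the connecting map is injective on Ext^i(N), so a preimage of
    the generator generates modulo [x]. *)
Lemma cyc_down i : cyc E i.+1 N' -> ext0 E i.+1 N -> cyc E i N.
Proof.
move=> [lam' [clam' hlam']] extN.
have [hp _ _] := qp; have hd := @ic_lin _ E.
have [k [hk kE ck]] := coc_liftx qp clam' extN.
apply: (cyc_nakayama fgN ck) => g cg.
have [h [g' [hh hE cg' g'E]]] := coc_divx regx qp cg.
have [a [u hu uE]] := hlam' _ cg'.
exists a, 'I_1, (fun=> x), (fun=> fun v => h v - a *: k v - u (p v)); split=> // [_|].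
  split=> [|v].
    by apply: lin_sub (lin_comp hu hp); apply: lin_sub hh (lin_scale _ hk).
  by rewrite !(linB _ _ (hd i)) (linZ _ _ (hd i)) g'E kE -uE subrr.
apply: (cob_eq _ (@cob_submod _ E N i).1) => v.
rewrite big_ord1 !scalerBr -hE -(linZ _ _ hu) -(linZ _ _ hp) (quotx qp).
rewrite (lin0 hu) subr0 [x *: (a *: _)]scalerA [x * a]mulrC -scalerA.
by rewrite subKr subrr.
Qed.

End Regular.

End FiniteCohomology.

(** * Regular sequences *)

Section RegularSequences.
Variable R : comNzRingType.
Implicit Types M N : lmodType R.

Definition addm M (K : set M) (x : R) : set M :=
  [set z | exists k v, K k /\ z = k + x *: v].

Definition regular_on M (K : set M) (x : R) : Prop :=
  forall v, K (x *: v) -> K v.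

Fixpoint regseq M (K : set M) (xs : seq R) : Prop :=
  if xs is x :: xs' then regular_on K x /\ regseq (addm K x) xs' else True.

Lemma addm_submod M (K : set M) x : submod K -> submod (addm K x).
Proof.
move=> hK; split=> [|a _ _ [k [v [Kk ->]]] [l [w [Kl ->]]]].
  by exists 0, 0; split; [case: hK | rewrite scaler0 addr0].
exists (a *: k + l), (a *: v + w); split; first exact: hK.2.
by rewrite !scalerDr addrACA !scalerA [x * a]mulrC.
Qed.

Lemma addm_sub M (K : set M) x : K `<=` addm K x.
Proof. by move=> k Kk; exists k, 0; rewrite scaler0 addr0. Qed.

Lemma addm_seq_submod M (K : set M) xs : submod K -> submod (foldl (@addm M) K xs).
Proof. by elim: xs K => //= x xs IHxs K hK; apply/IHxs/addm_submod. Qed.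

Lemma addmC M (K : set M) x y : addm (addm K x) y = addm (addm K y) x.
Proof.
suff sub a b : addm (addm K a) b `<=` addm (addm K b) a by apply/seteqP; split.
move=> _ [_ [v [[k [w [Kk ->]]] ->]]]; exists (k + b *: v), w; split.
  by exists k, v.
by rewrite addrAC.
Qed.

(** The case of 0 -> M/(K : a) -> M/K -> M/(K + aM) -> 0 in the principle that
    a sequence regular on both ends of an extension is regular on the middle. *)
Lemma regseq_extension M (K : set M) a xs : submod K ->
  regseq [set v | K (a *: v)] xs -> regseq (addm K a) xs -> regseq K xs.
Proof.
elim: xs K => //= x xs IHxs K hK [reg1 h1] [reg2 h2].
have regx : regular_on K x.
  move=> r Kxr; have [k [s [Kk rE]]] := reg2 r (addm_sub (K := K) a Kxr).
  rewrite rE; apply: submodD => //; apply: reg1 => /=.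
  rewrite scalerA mulrC -scalerA -[a *: s](addKr k) -rE addrC scalerBr.
  by apply: submodB => //; exact: submodZ.
split=> //; apply: IHxs; first exact: addm_submod.
  suff -> : [set v | addm K x (a *: v)] = addm [set v | K (a *: v)] x by [].
  apply/seteqP; split=> [s [k [t [Kk sE]]]|_ [k [t [Kk ->]]]]; last first.
    exists (a *: k), (a *: t); split=> //.
    by rewrite scalerDr !scalerA mulrC.
  have [|j [u [Kj tE]]] := reg2 t.
    by exists (- k), s; split; [exact: submodN | rewrite sE addKr].
  exists (s - x *: u), u; rewrite subrK; split=> //=.
  rewrite scalerBr sE tE scalerDr !scalerA [a * x]mulrC addrA addrK.
  by apply: submodD => //; exact: submodZ.
by rewrite addmC.
Qed.

Lemma regular_on_exp M (K : set M) x n : regular_on K x -> regular_on K (x ^+ n).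
Proof.
move=> regx; elim: n => [|n IHn] v; first by rewrite expr0 scale1r.
by rewrite exprS -scalerA => /regx/IHn.
Qed.

(** The element x^(n+1) is treated by induction on n, since
    (K + x^(n+1) M : x) = K + x^n M when [x] is regular on M/K. *)
Lemma regseq_exp M (K : set M) xs n : (0 < n)%N -> submod K ->
  regseq K xs -> regseq K [seq x ^+ n | x <- xs].
Proof.
case: n => // n _; elim: xs K => //= x xs IHxs K hK [regx h].
split; first exact: regular_on_exp.
apply: IHxs; first exact: addm_submod.
elim: n => [|n IHn] //; apply: (@regseq_extension _ _ x).
- exact: addm_submod.
- suff -> : [set v | addm K (x ^+ n.+2) (x *: v)] = addm K (x ^+ n.+1) by [].
  apply/seteqP; split=> [s [k [t [Kk sE]]]|_ [k [t [Kk ->]]]]; last first.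
    exists (x *: k), t; split; first exact: submodZ.
    by rewrite scalerDr scalerA -exprS.
  exists (s - x ^+ n.+1 *: t), t; rewrite subrK; split=> //.
  by apply: regx; rewrite scalerBr scalerA -exprS sE addrK.
- suff -> : addm (addm K (x ^+ n.+2)) x = addm K x by [].
  apply/seteqP; split=> [z [y [v [[k [w [Kk ->]]] ->]]]|].
    exists k, (x ^+ n.+1 *: w + v); split=> //.
    by rewrite scalerDr scalerA -exprS addrA.
  move=> _ [k [v [Kk ->]]]; exists k, v; split=> //; exact: addm_sub.
Qed.

Lemma is_quot_step M N N' (K : set M) x (q : M -> N) (q' : M -> N') :
  is_quot K q -> is_quot (addm K x) q' ->
  exists p : N -> N', is_quot [set z | exists v : N, z = x *: v] p.
Proof.
move=> [hq sq kq] [hq' sq' kq'].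
have [|p hp pE] := quot_factor hq sq hq'.
  by move=> v /kq Kv; apply/kq'; exact: addm_sub.
exists p; split=> // [y|z].
  by have [v <-] := sq' y; exists (q v).
have [w <-] := sq z; rewrite pE; split=> [/kq'[k [v [/kq qk wE]]]|[y qwy]].
  by exists (q v); rewrite wE linD // qk add0r linZ.
have [v vy] := sq y; have /kq Kw : q (w - x *: v) = 0.
  by rewrite linB // linZ // vy qwy subrr.
apply/kq'.
by exists (w - x *: v), v; rewrite subrK.
Qed.

Lemma is_quot_regular M N (K : set M) x (q : M -> N) : is_quot K q ->
  regular_on K x -> forall v : N, x *: v = 0 -> v = 0.
Proof.
move=> [hq sq kq] regx v; have [w <-] := sq v.
by rewrite -linZ // => /kq/regx/kq.
Qed.

Section Induction.
Variables (m : set R) (P : nat -> lmodType R -> Prop).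

(** The situation of N' = N/xN, in which both inductions along a regular
    sequence pass a property from one module to the other. *)
Definition quotient_step (Q : nat -> lmodType R -> nat -> lmodType R -> Prop) :=
  forall k x N N' (p : N -> N'), m x -> fg N ->
    (forall v : N, x *: v = 0 -> v = 0) ->
    is_quot [set z | exists v : N, z = x *: v] p -> Q k N k.+1 N'.

Variables (M : lmodType R) (fgM : fg M).

Lemma regseq_up : quotient_step (fun k N k' N' => P k N -> P k' N') ->
  forall xs (K : set M) k, submod K -> regseq K xs -> (forall x, x \in xs -> m x) ->
  (forall N (q : M -> N), is_quot K q -> P k N) ->
  forall N (q : M -> N), is_quot (foldl (@addm M) K xs) q -> P (k + size xs) N.
Proof.
move=> step; elim=> [|x xs IHxs] K k hK /=.
  by rewrite addn0 => _ _ PK N q /PK.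
move=> [regx h] mxs PK; rewrite -addSnnS; apply: IHxs => //.
- exact: addm_submod.
- by move=> y yxs; apply: mxs; rewrite inE yxs orbT.
move=> N' q' qq'; have [N [q qq]] := quotient_exists hK.
have [p qp] := is_quot_step qq qq'; apply: step qp (PK _ _ qq).
- by apply: mxs; rewrite inE eqxx.
- by case: qq => hq sq _; exact: fg_surj fgM.
- exact: is_quot_regular qq regx.
Qed.

Lemma regseq_down : quotient_step (fun k N k' N' => P k' N' -> P k N) ->
  forall xs (K : set M) k, submod K -> regseq K xs -> (forall x, x \in xs -> m x) ->
  (forall N (q : M -> N), is_quot (foldl (@addm M) K xs) q -> P (k + size xs) N) ->
  forall N (q : M -> N), is_quot K q -> P k N.
Proof.
move=> step; elim=> [|x xs IHxs] K k hK /=.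
  by rewrite addn0 => _ _ PK N q /PK.
move=> [regx h] mxs PK N q qq; have hK' := addm_submod x hK.
have [N' [q' qq']] := quotient_exists hK'.
have [p qp] := is_quot_step qq qq'.
have mxs' y : y \in xs -> m y by move=> yxs; apply: mxs; rewrite inE yxs orbT.
have PN' : P k.+1 N'.
  by apply: IHxs hK' h mxs' _ _ _ qq'; rewrite addSnnS.
apply: step qp PN'.
- by apply: mxs; rewrite inE eqxx.
- by case: qq => hq sq _; exact: fg_surj fgM.
- exact: is_quot_regular qq regx.
Qed.

End Induction.

End RegularSequences.

Local Notation idquot I p := (@is_quot _ _^o _ I p).

(** Right exactness of the cohomology in the top degree. *)
Lemma coc_extend_van (R : comNzRingType) (E : icomplex R) i (A B : lmodType R)
    (f : A -> B) (g : A -> E i) :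
  (forall L, fg L -> ext0 E i.+1 L) -> lin f -> fg B ->
  coc g -> (forall a, f a = 0 -> g a = 0) ->
  exists2 g' : B -> E i, coc g' & forall v, g' (f v) = g v.
Proof.
move=> van hf fgB cg kg.
have [C [r qr]] := quotient_exists (range_submod hf); have [hr sr _] := qr.
apply: (coc_extend hf qr _ cg kg); apply: van; exact: fg_surj hr sr fgB.
Qed.

Section Depth.
Variables (R : comNzRingType) (m : set R).
Hypotheses (noethR : noetherian R) (locR : local_ring m).
Implicit Types M N : lmodType R.

Lemma regseq_ext0_down (E : icomplex R) M (K : set M) xs j N (q : M -> N) :
  fg M -> submod K -> regseq K xs -> (forall x, x \in xs -> m x) ->
  (forall i, (j + size xs <= i)%N -> forall L, fg L -> ext0 E i L) ->
  is_quot K q -> forall i, (j <= i)%N -> ext0 E i N.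
Proof.
move=> fgM hK hxs mxs van qq.
apply: (regseq_down (m := m) (P := fun j N => forall i, (j <= i)%N -> ext0 E i N)
  fgM _ hK hxs mxs _ qq).
- move=> k x N1 N2 p mx fgN regx qp PN i ki.
  by apply: (ext0_down noethR locR regx qp) => //; exact: PN.
- move=> N' q' [hq' sq' _] i ji; apply: van => //; exact: fg_surj fgM.
Qed.

Lemma regseq_ext0_up (E : icomplex R) M (K : set M) xs j :
  fg M -> submod K -> regseq K xs -> (forall x, x \in xs -> m x) ->
  (forall N (q : M -> N), is_quot K q -> forall i, (j < i)%N -> ext0 E i N) ->
  forall N (q : M -> N), is_quot (foldl (@addm _ M) K xs) q ->
  forall i, (j + size xs < i)%N -> ext0 E i N.
Proof.
move=> fgM hK hxs mxs PK N q qq.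
apply: (regseq_up (m := m) (P := fun j N => forall i, (j < i)%N -> ext0 E i N)
  fgM _ hK hxs mxs PK qq).
move=> k x N1 N2 p mx fgN regx qp PN [//|i] ki.
by apply: (ext0_up regx qp); apply: PN => //; exact: ltnW.
Qed.

Lemma regseq_cyc_up (E : icomplex R) M (K : set M) xs j :
  fg M -> submod K -> regseq K xs -> (forall x, x \in xs -> m x) ->
  (forall N (q : M -> N), is_quot K q ->
     cyc E j N /\ forall i, (j < i)%N -> ext0 E i N) ->
  forall N (q : M -> N), is_quot (foldl (@addm _ M) K xs) q ->
  cyc E (j + size xs) N.
Proof.
move=> fgM hK hxs mxs PK N q qq.
pose P j N := cyc E j N /\ forall i, (j < i)%N -> ext0 E i N.
have [//] : P (j + size xs)%N N.
apply: (regseq_up (m := m) (P := P) fgM _ hK hxs mxs PK qq).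
move=> k x N1 N2 p mx fgN regx qp [cN PN].
split; first exact: (cyc_up regx qp cN (PN _ (ltnSn k))).
by move=> [//|i] ki; apply: (ext0_up regx qp); apply: PN => //; exact: ltnW.
Qed.

Lemma regseq_cyc_down (E : icomplex R) M (K : set M) xs j :
  fg M -> submod K -> regseq K xs -> (forall x, x \in xs -> m x) ->
  (forall N (q : M -> N), is_quot (foldl (@addm _ M) K xs) q ->
     cyc E (j + size xs) N) ->
  forall N (q : M -> N), is_quot K q -> (forall i, (j < i)%N -> ext0 E i N) ->
  cyc E j N.
Proof.
move=> fgM hK hxs mxs PK N q qq.
apply: (regseq_down (m := m)
  (P := fun j N => (forall i, (j < i)%N -> ext0 E i N) -> cyc E j N)
  fgM _ hK hxs mxs _ qq); last by move=> N' q' /PK.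
move=> k x N1 N2 p mx fgN regx qp PN ext.
apply: (cyc_down noethR locR regx qp mx fgN); last exact: ext.
apply: PN => -[//|i] ki.
by apply: (ext0_up regx qp); apply: ext => //; exact: ltnW.
Qed.

(** Noetherian induction on the annihilator [I] of a cyclic module: for [y] in
    [m] but not in [I], either [y] is regular on [R/I], or
    0 -> R/(I : y) -> R/I -> R/(I + y) -> 0 has smaller ends. *)
Lemma ext0_cyclic (E : icomplex R) i :
  (forall N, fg N -> ext0 E i.+1 N) ->
  (forall N (p : R^o -> N), idquot m p -> ext0 E i N) ->
  forall I, is_ideal I -> forall N (p : R^o -> N), idquot I p -> ext0 E i N.
Proof.
move=> van extk; apply: (noeth_ind noethR) => I hI IH N p qp.
have [hp sp kp] := qp.
have [I1|nI1] := pselect (I 1).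
  apply: ext0_zero => v; have [r <-] := sp v; apply/kp.
  by rewrite -[r]mulr1; apply: (submodZ (ideal_submod hI)).
have Im := proper_sub_local noethR locR hI nI1.
have [mI|nmI] := pselect (m `<=` I).
  by apply: extk (p) _; rewrite (_ : m = I) //; apply/seteqP.
have [y [my nIy]] : exists y, m y /\ ~ I y.
  apply: contrapT => no; apply: nmI => y my; apply: contrapT => nIy.
  by apply: no; exists y.
have hI' : @submod R R^o I := hI.
have hIy : is_ideal [set v : R | I (y * v)].
  split=> [|a u v /= Iu Iv]; first by rewrite /= mulr0; case: hI.
  by rewrite /= mulrDr mulrCA; apply: hI.2.
have [N2 [p2 qp2]] := quotient_exists (addm_submod y hI').
have [r qr] := is_quot_step qp qp2.
have fgN : fg N := fg_surj hp sp (fg_R R).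
have [reg|nreg] := pselect (regular_on (I : set R^o) y).
  apply: (ext0_down noethR locR (is_quot_regular qp reg) qr my fgN).
  by apply: van; case: qp2 => hp2 sp2 _; exact: fg_surj hp2 sp2 (fg_R R).
have [N1 [p1 qp1]] := quotient_exists (ideal_submod hIy).
have [hp1 sp1 kp1] := qp1.
have hyp : lin (fun v : R^o => p (y *: v)).
  by apply: lin_comp hp _; exact: lin_scale (@lin_id _ _).
have [|f hf fE] := quot_factor hp1 sp1 hyp; first by move=> v /kp1 Iv; apply/kp.
apply: (@ext0_mid _ E N1 N N2 i f r) => //.
- apply: lin_inj => // w; have [x <-] := sp1 w.
  by rewrite fE => /kp Iyx; apply/kp1.
- have [hr sr kr] := qr; split=> // z; split=> [/kr[v ->]|[v _ <-]].
    by have [x <-] := sp v; exists (p1 x) => //; rewrite fE linZ.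
  by apply/kr; have [x <-] := sp1 v; exists (p x); rewrite fE linZ.
- apply: (IH _ hIy) qp1 => [v Iv /=|sub].
    by rewrite /= mulrC in Iv *; rewrite mulrC; apply: (submodZ hI').
  by apply: nreg => v /sub.
- apply: (IH _ (addm_submod y hI')) qp2; first exact: (@addm_sub _ R^o I y).
  move=> sub; apply: nIy; apply: sub; exists 0, 1; split; first by case: hI.
  by rewrite add0r; exact/esym/mulr1.
Qed.

(** The submodule generated by one generator is cyclic, and its quotient has
    one generator less. *)
Lemma ext0_all (E : icomplex R) i :
  (forall N, fg N -> ext0 E i.+1 N) ->
  (forall N (p : R^o -> N), idquot m p -> ext0 E i N) ->
  forall N, fg N -> ext0 E i N.
Proof.
move=> van extk N /fgset_ord[n [g [_ gN]]].
have {}gN v : exists c, v = \sum_i c i *: g i by exact: gN.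
elim: n N g gN => [|n IHn] N g gN.
  by apply: ext0_zero => v; have [c ->] := gN v; rewrite big_ord0.
have hg : lin (fun a : R^o => (a : R) *: g ord0).
  by move=> a x y; rewrite scalerDl scalerA.
have hA : @submod R R^o [set a | a *: g ord0 = 0].
  split=> [|a x y /= x0 y0]; first by rewrite /= scale0r.
  by rewrite /= scalerDl -scalerA x0 y0 scaler0 addr0.
have [A [p qp]] := quotient_exists hA; have [hp sp kp] := qp.
have [|f hf fE] := quot_factor hp sp hg; first by move=> x /kp.
have [C [r qr]] := quotient_exists (range_submod hf); have [hr sr kr] := qr.
apply: (ext0_mid hf _ qr).
- apply: lin_inj => // w; have [x <-] := sp w.
  by rewrite fE => ax; apply/kp.
- exact: ext0_cyclic van extk _ hA _ _ qp.
apply: (IHn _ (fun i => r (g (lift ord0 i)))) => y; have [v <-] := sr y.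
have [c ->] := gN v; exists (fun i => c (lift ord0 i)).
rewrite big_ord_recl linD // (_ : r (c ord0 *: _) = 0); last first.
  by apply/kr; exists (p (c ord0)); rewrite ?fE.
by rewrite add0r lin_sum //; apply: eq_bigr => k _; rewrite linZ.
Qed.

End Depth.

(** * Socles *)

Section Socle.
Variables (R : comNzRingType) (m : set R).
Hypotheses (noethR : noetherian R) (locR : local_ring m).

Section MaximalAnnihilators.
Variable J : set R.
Hypothesis hJ : is_ideal J.

Let hJs := ideal_submod hJ.

Lemma ann_ideal r : is_ideal [set x | J (x * r)].
Proof.
split=> [|a x y /= xr yr]; first by rewrite /= mul0r; case: hJ.
by rewrite /= mulrDl -mulrA; apply: hJ.2.
Qed.

(** The annihilators of nonzero elements of [R/J] that are maximal among
    these; they are prime, and are the maximal associated primes of [R/J]. *)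
Definition maxann (r : R) : Prop := ~ J r /\
  forall r', ~ J r' -> (forall x, J (x * r) -> J (x * r')) ->
  forall x, J (x * r') -> J (x * r).

Lemma maxann_prime r x y : maxann r -> J (x * y * r) -> ~ J (y * r) -> J (x * r).
Proof.
move=> [_ mr] Jxyr nJ; apply: mr nJ _ _ _; last by rewrite mulrA.
by move=> z Jzr; rewrite mulrCA; apply: (submodZ hJs).
Qed.

(** A prime that contains a product contains a factor. *)
Lemma maxann_product (rs : seq R) r : maxann r ->
  (forall s, s \in rs -> exists2 z, J (z * s) & ~ J (z * r)) ->
  exists2 z, forall s, s \in rs -> J (z * s) & ~ J (z * r).
Proof.
move=> mr; elim: rs => [|s rs IHrs] h; first by exists 1 => //; rewrite mul1r; case: mr.
have [|z zP nJz] := IHrs; first by move=> t trs; apply: h; rewrite inE trs orbT.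
have [|w Jw nJw] := h s; first by rewrite inE eqxx.
exists (z * w) => [t|/(maxann_prime mr)/(_ nJw)//].
rewrite inE => /predU1P[->|/zP Jzt].
  by rewrite -mulrA; apply: (submodZ hJs).
by rewrite mulrAC mulrC; apply: (submodZ hJs).
Qed.

Lemma maxann_exists r : ~ J r ->
  exists r', maxann r' /\ forall x, J (x * r) -> J (x * r').
Proof.
move=> nJr; pose P I := forall r, I = [set x | J (x * r)] -> ~ J r ->
  exists r', maxann r' /\ forall x, J (x * r) -> J (x * r').
suff h I : is_ideal I -> P I by exact: (h _ (ann_ideal r) r erefl nJr).
apply: (noeth_ind noethR) => {r nJr}{}I hI IH r IE nJr.
have [mr|nmr] := pselect (maxann r); first by exists r.
have [r1 [nJr1 sub nsub]] : exists r1, [/\ ~ J r1,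
    forall x, J (x * r) -> J (x * r1) & ~ forall x, J (x * r1) -> J (x * r)].
  apply: contrapT => no; apply: nmr; split=> // r1 nJr1 sub.
  by apply: contrapT => nsub; apply: no; exists r1.
have [||r' [mr' r'P]] := IH _ (ann_ideal r1) _ _ r1 erefl nJr1.
- by rewrite IE => x /sub.
- by rewrite IE.
by exists r'; split=> // x /sub/r'P.
Qed.

Lemma maxann_avoid (rs : seq R) : (forall r, r \in rs -> maxann r) ->
  (forall r, r \in rs -> exists2 a, m a & ~ J (a * r)) ->
  exists2 x, m x & forall r, r \in rs -> ~ J (x * r).
Proof.
have hm := ideal_submod (local_ideal locR).
elim: rs => [|r rs IHrs] mrs nrs; first by exists 0; first by case: hm.
have rsS s : s \in rs -> s \in r :: rs by move=> srs; rewrite inE srs orbT.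
have [x mx xP] := IHrs (fun s h => mrs s (rsS s h)) (fun s h => nrs s (rsS s h)).
have [Jxr|nJxr] := pselect (J (x * r)); last first.
  by exists x => // s; rewrite inE => /predU1P[->|/xP].
have mr : maxann r by apply: mrs; rewrite inE eqxx.
have [|a ma nJa] := nrs r; first by rewrite inE eqxx.
(* [x] is in Ann(r) and in none of the Ann(s), so by maximality none of the
   Ann(s) is contained in Ann(r) *)
have [z zP nJz] : exists2 z, forall s, s \in rs -> J (z * s) & ~ J (z * r).
  apply: (maxann_product mr) => s srs; apply: contrapT => no.
  apply: (xP s srs); have ms := mrs s (rsS s srs).
  apply: (ms.2 r mr.1) => // z Jzs.
  by apply: contrapT => nJz; apply: no; exists z.
exists (x + a * z); first by apply: (submodD hm) => //; rewrite mulrC; apply: (submodZ hm).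
move=> s; rewrite inE => /predU1P[->|srs].
  rewrite mulrDl => Jsum; apply: nJa; apply: maxann_prime mr _ nJz.
  by rewrite -(addKr (x * r) (a * z * r)); apply: (submodD hJs) => //; apply: (submodN hJs).
rewrite mulrDl => Jsum; apply: (xP s srs).
rewrite -(addrK (a * z * s) (x * s)); apply: (submodB hJs) => //.
by rewrite -mulrA; apply: (submodZ hJs); apply: zP.
Qed.

(** Maximal annihilators are found one by one outside the ideal generated by
    the previous elements, until that ideal contains all of them. *)
Lemma maxann_finite : exists rs : seq R, (forall r, r \in rs -> maxann r) /\
  forall r, maxann r -> ideal_gen [set` rs] r.
Proof.
pose P I := forall rs : seq R, I = ideal_gen [set` rs] ->
  (forall r, r \in rs -> maxann r) ->
  exists rs : seq R, (forall r, r \in rs -> maxann r) /\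
  forall r, maxann r -> ideal_gen [set` rs] r.
suff h I : is_ideal I -> P I.
  by apply: (h _ (ideal_gen_ideal [set` [::]])) (erefl) _.
apply: (noeth_ind noethR) => {}I hI IH rs IE mrs.
have [all|nall] := pselect (forall r, maxann r -> ideal_gen [set` rs] r).
  by exists rs.
have [r [mr nr]] : exists r, maxann r /\ ~ ideal_gen [set` rs] r.
  apply: contrapT => no; apply: nall => r mr; apply: contrapT => nr.
  by apply: no; exists r.
apply: (IH _ (ideal_gen_ideal [set` r :: rs]) _ _ _ erefl).
- rewrite IE; apply: ideal_gen_min; first exact: ideal_gen_ideal.
  by move=> s /= srs; apply: ideal_gen_sub; rewrite /= inE srs orbT.
- rewrite IE => sub; apply: nr; apply: sub; apply: ideal_gen_sub.
  by rewrite /= inE eqxx.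
- by move=> s; rewrite inE => /predU1P[->|/mrs].
Qed.

(** The zero divisors modulo [J] are covered by finitely many maximal
    annihilators, so m lies in one of them by prime avoidance. *)
Lemma socle_exists : (forall x, m x -> exists2 r, ~ J r & J (x * r)) ->
  exists2 s, ~ J s & forall x, m x -> J (x * s).
Proof.
move=> zdiv; have [rs [mrs rsP]] := maxann_finite.
have [[r rrs mr]|no] := pselect (exists2 r, r \in rs & forall x, m x -> J (x * r)).
  by exists r => //; case: (mrs r rrs).
have [|x mx xP] := maxann_avoid mrs.
  move=> r rrs; apply: contrapT => nr; apply: no; exists r => // x mx.
  by apply: contrapT => nJ; apply: nr; exists x.
have [r nJr Jxr] := zdiv x mx.
have [r' [mr' r'P]] := maxann_exists nJr.
have nJr' := mr'.1; exfalso.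
have {Jxr} Jxr' := r'P _ Jxr.
(* [r'] is a combination of the elements of [rs] *)
have [s srs sub] : exists2 s, s \in rs & forall z, J (z * s) -> J (z * r').
  apply: contrapT => nos.
  have [s srs|z zP nJz] := @maxann_product rs r' mr'.
    apply: contrapT => nz; apply: nos; exists s => // z Jz.
    by apply: contrapT => nJ; apply: nz; exists z.
  apply: nJz; have [b ->] := ideal_gen_seq (rsP r' mr').
  rewrite mulr_sumr; apply: (submod_sum hJs) => i.
  by rewrite mulrCA; apply: (submodZ hJs); apply: zP; rewrite mem_nth.
by apply: (xP s srs); apply: ((mrs s srs).2 r').
Qed.

End MaximalAnnihilators.

Lemma residue_kill (N : lmodType R) (p : R^o -> N) a (v : N) :
  idquot m p -> m a -> a *: v = 0.
Proof.
case=> hp sp kp ma; have [r <-] := sp v; rewrite -linZ //; apply/kp.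
have -> : a *: r = r *: (a : R^o) by exact: mulrC.
exact: (submodZ (ideal_submod (local_ideal locR))).
Qed.

Lemma residue_embedding (J : set R) (B N : lmodType R) (q : R^o -> B)
    (p : R^o -> N) s : is_ideal J -> idquot J q -> idquot m p ->
  ~ J s -> (forall x, m x -> J (x * s)) ->
  exists f : N -> B, [/\ lin f, injective f & forall r, f (p r) = q (r * s)].
Proof.
move=> hJ [hq sq kq] [hp sp kp] nJs ms.
have hg : lin (fun r : R^o => q ((r : R) * s)).
  by move=> a x y; rewrite mulrDl -mulrA hq.
have [|f hf fE] := quot_factor hp sp hg; first by move=> r /kp/ms Jrs; apply/kq.
exists f; split=> //; apply: lin_inj => // w; have [r <-] := sp w.
rewrite fE => /kq Jrs; apply/kp; apply: contrapT => nmr; apply: nJs.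
have [u ur] := local_unit noethR locR nmr.
by rewrite -[s]mul1r -ur -mulrA; apply: (submodZ (ideal_submod hJ)).
Qed.

End Socle.

(** * Injective dimension and depth *)

Definition zero_set (R : comNzRingType) (M : lmodType R) : set M :=
  [set v | v = 0].

Lemma zero_submod (R : comNzRingType) (M : lmodType R) : submod (@zero_set R M).
Proof. by split=> // a x y -> ->; rewrite scaler0 addr0. Qed.

Lemma zero_quot (R : comNzRingType) (M : lmodType R) :
  @is_quot R M M (@zero_set R M) id.
Proof. by split=> // y; exists y. Qed.

Section Depth.
Variables (R : comNzRingType) (m : set R) (E : icomplex R).
Hypotheses (noethR : noetherian R) (locR : local_ring m).
Implicit Types M N : lmodType R.

Lemma zero_quot_inv N (q : R^o -> N) : is_quot (@zero_set R R^o) q ->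
  exists2 s : N -> R^o, lin s & forall v, q (s v) = v.
Proof.
move=> [hq sq kq].
have [|s hs sE] := quot_factor hq sq (@lin_id _ R^o); first by move=> x /kq.
by exists s => // v; have [r <-] := sq v; rewrite sE.
Qed.

Lemma zero_quot_ext0 i N (q : R^o -> N) : is_quot (@zero_set R R^o) q ->
  ext0 E i (R^o : lmodType R) -> ext0 E i N.
Proof.
move=> qq extR g cg; have [s hs sE] := zero_quot_inv qq; have [hq _ _] := qq.
by apply: cob_eq (cob_comp hs (extR _ (coc_comp hq cg))) => v; rewrite sE.
Qed.

Lemma zero_quot_cyc i N (q : R^o -> N) : is_quot (@zero_set R R^o) q ->
  cyc E i (R^o : lmodType R) -> cyc E i N.
Proof.
move=> qq [lam [clam hlam]].
have [s hs sE] := zero_quot_inv qq; have [hq _ _] := qq.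
exists (fun v => lam (s v)); split=> [|g cg]; first exact: coc_comp.
have [a ca] := hlam _ (coc_comp hq cg); exists a.
by apply: cob_eq (cob_comp hs ca) => v; rewrite sE.
Qed.

Lemma regseq_rcons M (K : set M) xs x : regseq K xs ->
  regular_on (foldl (@addm _ M) K xs) x -> regseq K (rcons xs x).
Proof.
by elim: xs K => [|y xs IHxs] K /= => [_ //|[regy /IHxs h]] /h.
Qed.

Definition mregseq (xs : seq R) :=
  regseq (@zero_set R R^o) xs /\ forall x, x \in xs -> m x.

Definition regseq_ideal (xs : seq R) : set R :=
  foldl (@addm R R^o) (@zero_set R R^o) xs.

Lemma regseq_ideal_ideal xs : is_ideal (regseq_ideal xs).
Proof. exact: (addm_seq_submod xs (@zero_submod R R^o)). Qed.

Definition max_regseq xs := mregseq xs /\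
  forall ys, mregseq ys -> (size ys <= size xs)%N.

Hypothesis E0 : ~ ext0 E 0 (R^o : lmodType R).

(** Otherwise the vanishing would climb down to Ext^0(R, ker d_0). *)
Lemma regseq_ext0_nonzero xs : mregseq xs ->
  ~ forall i, (size xs <= i)%N -> forall L, fg L -> ext0 E i L.
Proof.
move=> [hxs mxs] van; apply: E0.
by apply: (regseq_ext0_down (j := 0) noethR locR (fg_R R) (@zero_submod R R^o)
  hxs mxs van (@zero_quot R R^o)).
Qed.

Lemma max_regseq_exists : exists xs, max_regseq xs.
Proof.
have [n bn] := ext0_bound E.
have bound xs : mregseq xs -> (size xs <= n)%N.
  move=> hxs; rewrite leqNgt; apply/negP => nxs.
  apply: (regseq_ext0_nonzero hxs) => i xi L _; apply: bn.
  exact: leq_trans nxs xi.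
pose P k := `[< exists2 xs, mregseq xs & size xs = k >].
have exP : exists k, P k by exists 0%N; apply/asboolP; exists [::].
have ubP k : P k -> (k <= n)%N by move=> /asboolP[xs /bound] h <-.
case: (ex_maxnP exP ubP) => k /asboolP[xs hxs <-] kmax; exists xs; split=> //.
by move=> ys hys; apply: kmax; apply/asboolP; exists ys.
Qed.

Lemma max_regseq_socle xs : max_regseq xs ->
  exists2 s, ~ regseq_ideal xs s & forall x, m x -> regseq_ideal xs (x * s).
Proof.
move=> [[hxs mxs] max]; apply: (socle_exists noethR locR).
  exact: regseq_ideal_ideal.
move=> x mx; apply: contrapT => no.
have /max : mregseq (rcons xs x).
  split; last by move=> y; rewrite mem_rcons inE => /predU1P[->|/mxs].
  apply: regseq_rcons => // v Jxv; apply: contrapT => nJv; apply: no.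
  by exists v.
by rewrite size_rcons ltnn.
Qed.

Lemma max_regseq_exp xs n : (0 < n)%N -> max_regseq xs ->
  max_regseq [seq x ^+ n | x <- xs].
Proof.
move=> n0 [[hxs mxs] max]; split; last by move=> ys /max; rewrite size_map.
split; first exact: (regseq_exp n0 (@zero_submod R R^o)).
move=> _ /mapP[x /mxs mx ->]; case: n n0 => // n _.
by rewrite exprSr; apply: (submodZ (ideal_submod (local_ideal locR))).
Qed.

Section MaxRegseq.
Variable xs : seq R.
Hypothesis maxxs : max_regseq xs.

Lemma max_regseq_quot i N (q : R^o -> N) : idquot (regseq_ideal xs) q ->
  (size xs < i)%N -> ext0 E i N.
Proof.
have [[hxs mxs] _] := maxxs => qq.
apply: (regseq_ext0_up (m := m) (j := 0) (fg_R R) (@zero_submod R R^o) hxs mxs _ qq).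
move=> L p [hp sp kp] [//|j] _.
by apply: (zero_quot_ext0 (q := p)) => //; exact: ext0_R.
Qed.

(** Downward induction from the length of the resolution: a socle element of
    [R/xs] embeds the residue field, so that the cohomology of the latter is
    squeezed between two vanishing groups. *)
Lemma max_regseq_van i : (size xs < i)%N -> forall N, fg N -> ext0 E i N.
Proof.
have [n bn] := ext0_bound E.
suff H k j : (size xs < j)%N -> (n < j + k)%N -> forall N, fg N -> ext0 E j N.
  by move=> xi; apply: (H n.+1 i xi); rewrite addnS ltnS leq_addl.
elim: k j => [|k IHk] j xj nj N fgN; first by apply: bn; rewrite addn0 in nj.
apply: (ext0_all noethR locR) fgN => [L|{}N p qp].
  by apply: IHk; [exact: leqW | rewrite addSnnS].
have [s nJs ms] := max_regseq_socle maxxs.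
have [B [q qq]] := quotient_exists (ideal_submod (regseq_ideal_ideal xs)).
have [f [hf injf fE]] :=
  residue_embedding noethR locR (regseq_ideal_ideal xs) qq qp nJs ms.
have [C [r qr]] := quotient_exists (range_submod hf).
apply: (ext0_left hf injf qr); first exact: max_regseq_quot qq xj.
have [hr sr _] := qr; have [hq sq _] := qq.
apply: IHk; [exact: leqW | by rewrite addSnnS|].
exact: fg_surj hr sr (fg_surj hq sq (fg_R R)).
Qed.

(** Otherwise the vanishing of [max_regseq_van] would start in degree
    [size xs], against [regseq_ext0_nonzero]. *)
Lemma max_regseq_residue :
  ~ forall N (p : R^o -> N), idquot m p -> ext0 E (size xs) N.
Proof.
move=> ext; apply: (regseq_ext0_nonzero maxxs.1) => i.
rewrite leq_eqVlt => /predU1P[<-|/max_regseq_van//].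
exact: (ext0_all noethR locR (max_regseq_van (ltnSn _)) ext).
Qed.

Section Gorenstein.
Hypothesis cycE : cyc E 0 (R^o : lmodType R).

Variables (B N : lmodType R) (q : R^o -> B) (p : R^o -> N).
Hypotheses (qq : idquot (regseq_ideal xs) q) (qp : idquot m p).

Let hJ := ideal_submod (regseq_ideal_ideal xs).

Lemma max_regseq_cyc : cyc E (size xs) B.
Proof.
have [[hxs mxs] _] := maxxs.
apply: (regseq_cyc_up (m := m) (j := 0) (fg_R R) (@zero_submod R R^o) hxs mxs _ qq).
move=> L p' qp'; split=> [|[//|j] _].
  exact: (zero_quot_cyc (q := p')).
by apply: (zero_quot_ext0 (q := p')) => //; exact: ext0_R.
Qed.

Lemma fgB : fg B.
Proof. by case: qq => hq sq _; exact: fg_surj hq sq (fg_R R). Qed.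

(** Right exactness: cocycles on a submodule of [B] are restrictions. *)
Lemma socle_generator lam (f : N -> B) : lin f -> injective f ->
  (forall g : B -> E (size xs), coc g -> exists a, cob (fun v => g v - a *: lam v)) ->
  forall g : N -> E (size xs), coc g ->
  exists a, cob (fun v => g v - a *: lam (f v)).
Proof.
move=> hf injf hlam g cg.
have [|g' cg' g'E] := coc_extend_van (max_regseq_van (ltnSn _)) hf fgB cg.
  by move=> a fa; rewrite -(lin0 cg.1); congr g; apply: injf; rewrite fa lin0.
have [a ca] := hlam _ cg'; exists a.
by apply: cob_eq (cob_comp hf ca) => v; rewrite g'E.
Qed.

(** The residue field has type one: its cohomology is a quotient of that of
    [R/xs], which is cyclic. *)
Lemma residue_cyc : cyc E (size xs) N.
Proof.
have [s nJs ms] := max_regseq_socle maxxs.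
have [f [hf injf _]] :=
  residue_embedding noethR locR (regseq_ideal_ideal xs) qq qp nJs ms.
have [lam [clam hlam]] := max_regseq_cyc.
exists (fun v => lam (f v)); split; first exact: coc_comp.
exact: socle_generator.
Qed.

(** Two independent socle elements would embed the square of the residue
    field in [R/xs], and a cocycle supported on one summand only would not be
    a multiple of the generator. *)
Lemma socle_unique s1 s2 : ~ regseq_ideal xs s1 ->
  (forall x, m x -> regseq_ideal xs (x * s1)) ->
  (forall x, m x -> regseq_ideal xs (x * s2)) ->
  @addm R R^o (regseq_ideal xs) s1 s2.
Proof.
move=> nJ1 ms1 ms2; apply: contrapT => nJ12.
have hJi := regseq_ideal_ideal xs.
have nJ2 : ~ regseq_ideal xs s2.
  by move=> Js2; apply: nJ12; exact: (@addm_sub _ R^o _ s1).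
have [f1 [hf1 injf1 f1E]] := residue_embedding noethR locR hJi qq qp nJ1 ms1.
have [f2 [hf2 injf2 f2E]] := residue_embedding noethR locR hJi qq qp nJ2 ms2.
have [hq sq kq] := qq; have [hp sp kp] := qp.
have [tau [ctau ntau]] : exists tau : N -> E (size xs), coc tau /\ ~ cob tau.
  apply: contrapT => no; apply: max_regseq_residue => L p' qp' g cg.
  have [hp' sp' kp'] := qp'.
  have [|u hu uE] := quot_factor hp sp hp'; first by move=> r /kp mr; apply/kp'.
  have [|w hw wE] := quot_factor hp' sp' hp; first by move=> r /kp' mr; apply/kp.
  have cgu : cob (fun v => g (u v)).
    apply: contrapT => ncob; apply: no; exists (fun v => g (u v)); split=> //.
    exact: coc_comp.
  apply: cob_eq (cob_comp hw cgu) => v; have [r <-] := sp' v.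
  by rewrite wE uE.
pose f (uv : (N * N)%type) := f1 uv.1 + f2 uv.2.
have hf : lin f by move=> a u v; rewrite /f hf1 hf2 scalerDr addrACA.
have hfst : lin (fst : (N * N)%type -> N) by [].
have [|g cg gE] := coc_extend_van (max_regseq_van (ltnSn _)) hf fgB (coc_comp hfst ctau).
  move=> [u v]; rewrite /f /=; have [a <-] := sp u; have [b <-] := sp v.
  rewrite f1E f2E -linD // => /kq Jab.
  suff /kp-> : m a by exact: lin0 ctau.1.
  have [mb|nmb] := pselect (m b).
    apply: contrapT => nma; apply: nJ1.
    have [c ca] := local_unit noethR locR nma.
    rewrite -[s1]mul1r -ca -mulrA; apply: (submodZ hJ).
    rewrite -(addrK (b * s2) (a * s1)); apply: (submodB hJ) => //.
    exact: ms2.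
  have [c cb] := local_unit noethR locR nmb; exfalso; apply: nJ12.
  exists (c * (a * s1 + b * s2)), (- (c * a)); split; first exact: (submodZ hJ).
  have -> : s1 *: (- (c * a) : R^o) = - (c * a * s1).
    exact: etrans (mulrN _ _) (congr1 -%R (mulrC _ _)).
  by rewrite mulrDr !mulrA cb mul1r addrAC subrr add0r.
have [lam [clam hlam]] := max_regseq_cyc.
have [r cr] := hlam g cg.
have inj1 : lin (fun v : N => (v, 0 : N)).
  by move=> a u v; congr (_, _); rewrite /= scaler0 addr0.
have inj2 : lin (fun v : N => (0 : N, v)).
  by move=> a u v; congr (_, _); rewrite /= scaler0 addr0.
have c1 := cob_comp inj1 (cob_comp hf cr).
have c2 := cob_comp inj2 (cob_comp hf cr).
have [mr|nmr] := pselect (m r).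
  apply: ntau; apply: cob_eq c1 => v.
  rewrite gE /f /= (lin0 hf2) addr0 -(linZ _ _ clam.1) -(linZ _ _ hf1).
  by rewrite (residue_kill locR _ qp mr) (lin0 hf1) (lin0 clam.1) subr0.
have [c cr1] := local_unit noethR locR nmr.
have clam2 : cob (fun v => lam (f2 v)).
  apply: cob_eq (cobZ (- c) c2) => v.
  rewrite gE /f /= (lin0 hf1) add0r (lin0 ctau.1) sub0r scaleNr scalerN opprK.
  by rewrite scalerA cr1 scale1r.
apply: ntau; have [a ca] := socle_generator hf2 injf2 hlam ctau.
by apply: cob_eq (cobD ca (cobZ a clam2)) => v; rewrite subrK.
Qed.

End Gorenstein.
End MaxRegseq.
End Depth.

(** * Restriction and coinduction along a ring endomorphism *)

(** Restriction of scalars along [phi]: F^e_* M when [phi] is the e-th iterate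
    of Frobenius. *)
Definition twist (R : comNzRingType) (phi : {rmorphism R -> R}) (M : lmodType R)
  : Type := M.

Section Twist.
Variables (R : comNzRingType) (phi : {rmorphism R -> R}).

Section Module.
Variable M : lmodType R.

HB.instance Definition _ := GRing.Zmodule.on (twist phi M).

Definition twist_scale (a : R) (x : twist phi M) : twist phi M :=
  phi a *: (x : M).

Lemma twist_scaleA a b x :
  twist_scale a (twist_scale b x) = twist_scale (a * b) x.
Proof. by rewrite /twist_scale scalerA rmorphM. Qed.

Lemma twist_scale1 : left_id 1 twist_scale.
Proof. by move=> x; rewrite /twist_scale rmorph1 scale1r. Qed.

Lemma twist_scaleDr : right_distributive twist_scale +%R.
Proof. by move=> a x y; exact: (scalerDr (phi a) (x : M) (y : M)). Qed.

Lemma twist_scaleDl x : {morph twist_scale^~ x : a b / a + b}.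
Proof. by move=> a b; rewrite /twist_scale rmorphD; exact: (scalerDl (x : M)). Qed.

HB.instance Definition _ := GRing.Zmodule_isLmodule.Build R (twist phi M)
  twist_scaleA twist_scale1 twist_scaleDr twist_scaleDl.

Lemma twistE a (x : M) : a *: (x : twist phi M) = phi a *: x.
Proof. by []. Qed.

End Module.

Local Notation F M := (twist phi M : lmodType R).
Local Notation S := (F R^o).
Implicit Types M N : lmodType R.

Lemma lin_twist M N (f : M -> N) : lin f -> @lin R (F M) (F N) f.
Proof. by move=> hf a x y; exact: hf. Qed.

Lemma twist_mul_lin M (s : R) : @lin R (F M) (F M) (fun v => s *: (v : M)).
Proof. exact: (lin_twist (lin_scale s (@lin_id R M))). Qed.

Lemma twist_orbit_lin M (v : M) : @lin R S (F M) (fun s => (s : R) *: v).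
Proof.
move=> a x y; rewrite -[RHS]/(phi a *: ((x : R) *: v) + (y : R) *: v).
by rewrite scalerA -scalerDl.
Qed.

Lemma fg_twist N : fg S -> fg N -> fg (F N).
Proof.
move=> [J [s [_ sP]]] [I [g [_ gP]]].
exists (I * J)%type, (fun ij => (s ij.2 : R) *: g ij.1); split=> // v _.
have [//|c vE] := gP v.
pose b i := projT1 (cid (sP (c i) Logic.I)).
have bE i : c i = \sum_j b i j *: (s j : S) by rewrite /b; case: cid.
exists (fun ij => b ij.1 ij.2).
rewrite -(pair_bigA _ (fun i j => b i j *: ((s j : R) *: g i : F N))) /= vE.
apply: eq_bigr => i _; rewrite bE (lin_sum _ (twist_orbit_lin (g i))).
by apply: eq_bigr => j _; rewrite (linZ _ _ (twist_orbit_lin (g i))).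
Qed.

Section Coinduced.
Variable M : lmodType R.

(** Hom_R(S, M), where S is R as a module over itself by way of [phi]; it is
    a module over the source of the action, that is, over S = R. *)
Record coind := Coind {coind_fun : R -> M; _ : `[< @lin R S M coind_fun >]}.

HB.instance Definition _ := [isSub for coind_fun].
HB.instance Definition _ := [Choice of coind by <:].

Lemma coind_closed : zmod_closed (fun f : R -> M => `[< @lin R S M f >]).
Proof.
split=> [|f g /asboolP hf /asboolP hg]; apply/asboolP.
  exact: (@lin_cst0 R S M).
exact: (@lin_sub R S M).
Qed.

HB.instance Definition _ := GRing.SubChoice_isSubZmodule.Build (R -> M) _ coind
  coind_closed.

Lemma coind_lin (f : coind) : @lin R S M (val f).
Proof. by case: f => f /= /asboolP. Qed.

Lemma coind_scale_subproof (r : R) (f : coind) :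
  `[< @lin R S M (fun s => val f (s * r)) >].
Proof.
apply/asboolP => a x y; rewrite -(coind_lin f); congr (val f _).
by rewrite -[LHS]/((phi a * x + y) * r) mulrDl -mulrA.
Qed.

Definition coind_scale r f := Coind (coind_scale_subproof r f).

Lemma coindD (f g : coind) s : val (f + g) s = val f s + val g s.
Proof. by []. Qed.

Lemma coind_ext (f g : coind) : (forall s, val f s = val g s) -> f = g.
Proof. by move=> fg; apply/val_inj/funext. Qed.

Lemma coind_scaleA a b f : coind_scale a (coind_scale b f) = coind_scale (a * b) f.
Proof. by apply: coind_ext => s /=; rewrite mulrA. Qed.

Lemma coind_scale1 : left_id 1 coind_scale.
Proof. by move=> f; apply: coind_ext => s /=; rewrite mulr1. Qed.

Lemma coind_scaleDr : right_distributive coind_scale +%R.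
Proof. by move=> a f g; apply: coind_ext. Qed.

Lemma coind_scaleDl f : {morph coind_scale^~ f : a b / a + b}.
Proof.
move=> a b; apply: coind_ext => s; rewrite coindD /= mulrDr.
by rewrite (linD _ _ (coind_lin f)).
Qed.

HB.instance Definition _ := GRing.Zmodule_isLmodule.Build R coind
  coind_scaleA coind_scale1 coind_scaleDr coind_scaleDl.

Lemma coindZ r (f : coind) s : val (r *: f) s = val f (s * r).
Proof. by []. Qed.

Definition coind_of (f : R -> M) (hf : @lin R S M f) : coind := Coind (asboolT hf).

End Coinduced.

Lemma coind_sum M (I : finType) (f : I -> coind M) s :
  val (\sum_i f i) s = \sum_i val (f i) s.
Proof. by apply: (big_morph (fun f : coind M => val f s)) => [x y|]. Qed.

Section Adjunction.
Variables (M N : lmodType R).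

Definition coind_down (g : N -> coind M) : F N -> M := fun v => val (g v) 1.

Lemma coind_down_lin (g : N -> coind M) : lin g -> lin (coind_down g).
Proof.
move=> hg a x y; rewrite /coind_down -[a *: x + y]/(phi a *: (x : N) + y).
rewrite hg coindD coindZ mul1r -[phi a]mulr1; congr (_ + _).
exact: (@linZ R (twist phi R^o) M _ a (1 : R^o) (coind_lin (g x))).
Qed.

Lemma coind_downE (g : N -> coind M) v s : lin g ->
  val (g v) s = coind_down g (s *: (v : N)).
Proof. by move=> hg; rewrite /coind_down linZ // coindZ mul1r. Qed.

Variables (f : F N -> M) (hf : lin f).

Lemma coind_up_subproof v : @lin R S M (fun s => f (s *: (v : N))).
Proof. exact: lin_comp hf (twist_orbit_lin v). Qed.

Definition coind_up (v : N) : coind M := coind_of (coind_up_subproof v).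

Lemma coind_up_lin : lin coind_up.
Proof.
move=> a x y; apply: coind_ext => s; rewrite coindD coindZ /=.
by rewrite scalerDr (linD _ _ hf) scalerA.
Qed.

End Adjunction.

Lemma coind_map_subproof M N (d : M -> N) (f : coind M) : lin d ->
  @lin R S N (fun s => d (val f s)).
Proof. by move=> hd; exact: lin_comp hd (coind_lin f). Qed.

(** Maps into Hom_R(S, M) are maps into M after restriction of scalars, which
    preserves injections. *)
Lemma coind_injective M : injective_module M -> injective_module (coind M : lmodType R).
Proof.
move=> injM A B i f inji.
have hf0 := coind_down_lin (linear_lin f).
have hi := linear_lin i.
have [|h0 hh0 h0E] := injective_extend injM (lin_twist hi) hf0.
  move=> a ia; rewrite (_ : a = 0) ?(lin0 hf0) //.
  by apply: inji; rewrite ia (lin0 hi).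
have [h hE] := lin_linear (coind_up_lin hh0).
exists h => a; rewrite hE; apply: coind_ext => s /=.
by rewrite -(linZ _ _ hi) h0E (coind_downE _ _ (linear_lin f)).
Qed.

End Twist.

Section CoinducedComplex.
Variables (R : comNzRingType) (phi : {rmorphism R -> R}) (E : icomplex R).
Local Notation F M := (twist phi M : lmodType R).
Local Notation S := (F R^o).
Implicit Types M N : lmodType R.

Hypotheses (noethR : noetherian R) (fgS : fg S).
Hypothesis extS : forall i, ext0 E i.+1 S.

Let coE i : lmodType R := coind phi (E i).
Let cod i (f : coE i) : coE i.+1 :=
  coind_of (coind_map_subproof f (@ic_lin _ E i)).

Lemma coind_d_lin i : lin (@cod i).
Proof.
move=> a f g; apply: coind_ext => s; rewrite coindD coindZ.
rewrite -[LHS]/(ic_d (val (a *: f + g) s)) coindD coindZ.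
exact: (linD _ _ (@ic_lin _ E i)).
Qed.

Lemma coind_d_exact i (f : coE i.+1) : cod f = 0 -> exists g, cod g = f.
Proof.
move=> df; have [|h hh hE] := extS (g := val f).
  split; first exact: coind_lin.
  by move=> s; rewrite -[LHS]/(val (cod f) s) df.
by exists (coind_of hh); apply: coind_ext => s; rewrite [RHS]hE.
Qed.

Lemma coind_fg0 : fgset [set f : coE 0%N | cod f = 0].
Proof.
have [J [G [cG GP]]] := ext_fg0 E noethR fgS.
exists J, (fun j => coind_of (cG j).1); split=> [j|f df].
  by apply: coind_ext => s; exact: (cG j).2.
have [|c cE] := GP (val f).
  split; first exact: coind_lin.
  by move=> s; rewrite -[LHS]/(val (cod f) s) df.
exists (fun j => phi (c j)); apply: coind_ext => s; rewrite coind_sum.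
move/eqP: (cE s); rewrite subr_eq0 => /eqP ->; apply: eq_bigr => j _.
rewrite coindZ /= mulrC; symmetry; exact: (@linZ R (twist phi R^o) _ _ (c j) s (cG j).1).
Qed.

(** Exactness in positive degrees is the vanishing of Ext^i_R(S, ker d_0). *)
Definition coind_complex : icomplex R.
Proof.
exists coE cod.
- exact: coind_d_lin.
- by move=> i f; apply: coind_ext => s; exact: ic_dd.
- by move=> i; apply: coind_injective; exact: ic_inj.
- exact: coind_d_exact.
- have [n bn] := ic_bound E; exists n => i ni f.
  by apply: coind_ext => s; exact: bn.
- exact: coind_fg0.
Defined.

Lemma coind_coc i N (g : N -> coind_complex i) : coc g ->
  coc (coind_down g : F N -> E i).
Proof.
move=> [hg dg]; split; first exact: (coind_down_lin hg).
by move=> v; rewrite -[LHS]/(val (@cod i (g v)) 1) [cod _]dg.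
Qed.

Lemma coind_coc_up i N (f : F N -> E i) (hf : lin f) : (forall v, ic_d (f v) = 0) ->
  coc (coind_up hf : N -> coind_complex i).
Proof.
move=> df; split; first exact: coind_up_lin.
by move=> v; apply: coind_ext => s; exact: df.
Qed.

Lemma coind_cob i N (g : N -> coind_complex i) : lin g ->
  cob (coind_down g : F N -> E i) -> cob g.
Proof.
case: i g => [|i] g hg /= => [g0 v|[h hh hE]].
  by apply: coind_ext => s; rewrite (coind_downE _ _ hg); exact: g0.
exists (coind_up hh : N -> coind_complex i); first exact: coind_up_lin.
by move=> v; apply: coind_ext => s; rewrite (coind_downE _ _ hg) hE.
Qed.

(** The adjunction Hom_S(N, Hom_R(S, E)) = Hom_R(N, E). *)
Lemma coind_ext0 i N : ext0 E i (F N) -> ext0 coind_complex i N.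
Proof.
by move=> ext g cg; apply: coind_cob; [case: cg | exact: ext (coind_coc cg)].
Qed.

End CoinducedComplex.

(** * Duality over the residue field *)

Section Residue.
Variables (R : comNzRingType) (m : set R).
Hypotheses (noethR : noetherian R) (locR : local_ring m).
Variables (k : lmodType R) (p : R^o -> k).
Hypothesis qp : idquot m p.
Implicit Types V N : lmodType R.

Let hp : lin p. Proof. by case: qp. Qed.
Let sp : forall y, exists x, p x = y. Proof. by case: qp. Qed.
Let kp x : p x = 0 <-> m x. Proof. by case: qp. Qed.

Lemma residue_gen (v : k) : exists a, v = a *: p 1.
Proof. by have [a <-] := sp v; exists a; rewrite -linZ //; congr p; exact/esym/mulr1. Qed.

Lemma residue_scale1 a : a *: p 1 = p a.
Proof. by rewrite -linZ //; congr p; exact: mulr1. Qed.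

(** V = k^n, by its coordinates and the inclusions of the summands. The
    generators are independent once none of them can be dropped. *)
Lemma residue_basis V : fg V -> (forall a (v : V), m a -> a *: v = 0) ->
  exists n (chi : 'I_n -> V -> k) (rho : 'I_n -> k -> V),
    [/\ forall i, lin (chi i), forall i, lin (rho i) &
        forall v, v = \sum_i rho i (chi i v)].
Proof.
move=> /fgset_ord[n [g [_ gV]]] mV.
have {}gV v : exists c, v = \sum_i c i *: g i by exact: gV.
elim: n g gV => [|n IHn] g gV.
  exists 0%N, (fun _ _ => 0), (fun _ _ => 0); split=> [[]//|[]//|v].
  by have [c ->] := gV v; rewrite !big_ord0.
have [ind|nind] := pselect (forall c, \sum_i c i *: g i = 0 -> forall i, m (c i)).
  have hl : lin (fun v : 'rV[R]_n.+1 => \sum_i v 0 i *: g i) by exact: rV_map.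
  have sl v : exists u : 'rV[R]_n.+1, \sum_i u 0 i *: g i = v.
    have [c ->] := gV v; exists (\row_i c i).
    by apply: eq_bigr => i _; rewrite mxE.
  have chi_ex i : exists2 chi : V -> k, lin chi &
      forall u : 'rV[R]_n.+1, chi (\sum_i u 0 i *: g i) = p (u 0 i).
    apply: (quot_factor hl sl) => [a x y|u u0]; first by rewrite !mxE hp.
    by apply/kp; exact: (ind (fun i => u 0 i)).
  have rho_ex i : exists2 rho : k -> V, lin rho & forall a, rho (p a) = a *: g i.
    apply: (quot_factor hp sp) => [a x y|x /kp mx]; last exact: mV.
    by rewrite scalerDl scalerA.
  pose chi i := s2val (cid2 (chi_ex i)); pose rho i := s2val (cid2 (rho_ex i)).
  have chiP i : lin (chi i) /\
      forall u : 'rV[R]_n.+1, chi i (\sum_i u 0 i *: g i) = p (u 0 i).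
    by split; [exact: s2valP (cid2 (chi_ex i)) | exact: s2valP' (cid2 (chi_ex i))].
  have rhoP i : lin (rho i) /\ forall a, rho i (p a) = a *: g i.
    by split; [exact: s2valP (cid2 (rho_ex i)) | exact: s2valP' (cid2 (rho_ex i))].
  exists n.+1, chi, rho; split=> [i|i|v]; [by case: (chiP i)|by case: (rhoP i)|].
  have [u <-] := sl v; apply: eq_bigr => i _.
  by rewrite (chiP i).2 (rhoP i).2.
have [c [c0 [i nmi]]] : exists c, \sum_i c i *: g i = 0 /\ exists i, ~ m (c i).
  apply: contrapT => no; apply: nind => c c0 i; apply: contrapT => nmi.
  by apply: no; exists c; split=> //; exists i.
have [u uc] := local_unit noethR locR nmi.
apply: (IHn (fun j => g (lift i j))) => v; have [b ->] := gV v.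
exists (fun j => b (lift i j) - b i * u * c (lift i j)).
under [RHS]eq_bigr => j _ do rewrite scalerBl.
rewrite sumrB (bigD1_ord i) //= addrC; congr (_ + _).
move/(congr1 (fun v => (b i * u) *: v)): c0.
rewrite (bigD1_ord i) //= scaler0 scalerDr scalerA -[b i * u * _]mulrA uc mulr1.
move/eqP; rewrite addr_eq0 => /eqP->; congr (- _).
by rewrite scaler_sumr; apply: eq_bigr => j _; rewrite scalerA.
Qed.

Lemma residue_fg : fg k.
Proof. exact: fg_surj hp sp (fg_R R). Qed.

(** Cohomology is additive and V is a power of k. *)
Lemma residue_coc (E : icomplex R) i V (tau : k -> E i) : fg V ->
  (forall a (v : V), m a -> a *: v = 0) ->
  (forall g : k -> E i, coc g -> exists a, cob (fun v => g v - a *: tau v)) ->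
  lin tau -> forall g : V -> E i, coc g ->
  exists2 f : V -> k, lin f & cob (fun v => g v - tau (f v)).
Proof.
move=> fgV mV htau ltau g cg.
have [n [chi [rho [hchi hrho vE]]]] := residue_basis fgV mV.
have c_ex j := htau _ (coc_comp (hrho j) cg).
pose c j := projT1 (cid (c_ex j)).
have cP j : cob (fun v => g (rho j v) - c j *: tau v) by rewrite /c; case: cid.
exists (fun v => \sum_j c j *: chi j v).
  by apply: lin_bigsum => j; exact: lin_scale.
have : cob (\sum_j (fun v => g (rho j (chi j v)) - c j *: tau (chi j v))).
  by apply: (submod_sum (@cob_submod _ E V i)) => j; exact: (cob_comp (hchi j) (cP j)).
apply: cob_eq => v; rewrite fct_sumE sumrB {3}[v]vE (lin_sum _ cg.1).
by rewrite (lin_sum _ ltau); congr (_ - _); apply: eq_bigr => j _; rewrite linZ.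
Qed.

Variable phi : {rmorphism R -> R}.
Local Notation F M := (twist phi M : lmodType R).
Hypothesis fgS : fg (F R^o).
Hypothesis phim : forall a, m a -> m (phi a).

Lemma twist_residue_fg : fg (F k).
Proof. exact: fg_twist fgS residue_fg. Qed.

Lemma twist_residue_kill a (v : F k) : m a -> a *: v = 0.
Proof. by move=> /phim ma; rewrite twistE (residue_kill locR _ qp). Qed.

Lemma residue_neq0 : p 1 <> 0.
Proof. by move=> /kp; exact: local_n1 locR. Qed.

(** Hom_k(F k, k) has dimension one over F k: a proper subspace of the form
    (F k) Phi would be killed by evaluation at some nonzero b, but then Phi
    vanishes on (F k) b = F k. *)
Lemma residue_dual_cyclic : exists2 Phi : F k -> k, lin Phi &
  forall f : F k -> k, lin f -> exists s : R, forall v, f v = Phi (s *: (v : k)).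
Proof.
have [n [chi [rho [hchi hrho vE]]]] :=
  residue_basis twist_residue_fg twist_residue_kill.
have [i0 chi1] : exists i, chi i (p 1) <> 0.
  apply: contrapT => no; apply: residue_neq0; rewrite [p 1](vE (p 1)).
  apply: big1 => i _; rewrite (_ : chi i _ = 0) ?lin0 //.
  by apply: contrapT => ni; apply: no; exists i.
pose Phi := chi i0; have hPhi : lin Phi := hchi i0.
exists Phi => // f hf.
have hPhis s : @lin R (F k) k (fun v => Phi (s *: (v : k))).
  exact: lin_comp hPhi (twist_mul_lin s).
pose e i : F k := rho i (p 1).
have gE v : exists t : 'I_n -> R, v = \sum_i t i *: e i.
  have t_ex i := residue_gen (chi i v).
  exists (fun i => projT1 (cid (t_ex i))); rewrite {1}[v]vE.
  apply: eq_bigr => i _; case: cid => t /= ->; exact: linZ.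
pose U : set 'rV[R]_n := [set u | exists s : R,
  forall i, p (u 0 i) = Phi (s *: (e i : k))].
have hU : submod U.
  split=> [|a u v [s us] [t vt]].
    by exists 0 => i; rewrite mxE scale0r !lin0.
  exists (phi a * s + t) => i; rewrite !mxE hp us vt scalerDl -scalerA.
  exact: esym (hPhi a (s *: (e i : k)) (t *: (e i : k))).
have [w wE] : exists w : 'rV[R]_n, forall i, p (w 0 i) = f (e i).
  have w_ex i := sp (f (e i)).
  exists (\row_i projT1 (cid (w_ex i))) => i; rewrite mxE; by case: cid.
suff [s sE] : U w.
  exists s => v; have [t ->] := gE v.
  rewrite (lin_sum _ hf) [RHS](lin_sum _ (hPhis s)).
  apply: eq_bigr => i _; rewrite (linZ _ _ hf) [RHS](linZ _ _ (hPhis s)).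
  by rewrite -wE sE.
apply: contrapT => nUw.
have [N [q [hq sq kq]]] := quotient_exists hU.
have [||n' [chi' [rho' [hchi' hrho' yE]]]] := @residue_basis N.
- exact: fg_surj hq sq (fg_rV R n).
- move=> a y ma; have [u <-] := sq y; rewrite -linZ //; apply/kq.
  exists 0 => i; rewrite scale0r (lin0 hPhi) mxE; apply/kp.
  by rewrite mulrC; apply: (submodZ (ideal_submod (local_ideal locR))).
have [j cj] : exists j, chi' j (q w) <> 0.
  apply: contrapT => no; apply: nUw; apply/kq; rewrite [q w]yE.
  apply: big1 => i _; rewrite (_ : chi' i _ = 0) ?lin0 //.
  by apply: contrapT => ni; apply: no; exists i.
have htheta : lin (fun u => chi' j (q u)) by exact: lin_comp.
have c_ex i := residue_gen (chi' j (q (delta_mx 0 i))).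
pose c i := projT1 (cid (c_ex i)).
have cE i : chi' j (q (delta_mx 0 i)) = c i *: p 1 by rewrite /c; case: cid.
have thetaE u : chi' j (q u) = \sum_i c i *: p (u 0 i).
  rewrite (rV_gen u htheta); apply: eq_bigr => i _.
  by rewrite cE scalerA mulrC -scalerA residue_scale1.
pose b : F k := \sum_i c i *: e i.
have Phib s : Phi (s *: (b : k)) = 0.
  have u_ex i := sp (Phi (s *: (e i : k))).
  pose u : 'rV[R]_n := \row_i projT1 (cid (u_ex i)).
  have uE i : p (u 0 i) = Phi (s *: (e i : k)) by rewrite mxE; case: cid.
  have /kq qu : U u by exists s.
  rewrite [LHS](lin_sum _ (hPhis s)).
  rewrite -[RHS](lin0 (hchi' j)) -qu thetaE; apply: eq_bigr => i _.
  by rewrite uE [LHS](linZ _ _ (hPhis s)).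
have fb : f b = chi' j (q w).
  rewrite thetaE (lin_sum _ hf); apply: eq_bigr => i _.
  by rewrite (linZ _ _ hf) wE.
have [r rE] := residue_gen b.
have [mr|nmr] := pselect (m r).
  by apply: cj; rewrite -fb rE (residue_kill locR _ qp) ?(lin0 hf).
have [u ur] := local_unit noethR locR nmr.
by apply: chi1; have := Phib u; rewrite rE scalerA ur scale1r.
Qed.

End Residue.

(** * Cyclicity of the canonical module *)

Section Cyclic.
Variables (R : comNzRingType) (m : set R).
Hypotheses (noethR : noetherian R) (locR : local_ring m).
Implicit Types M N : lmodType R.

(** In the top degree the cohomology is right exact, so that applying it to
    0 -> k -> B -> B^r, where r elements generate m, shows that modulo m the
    cohomology of B is that of its socle k. *)
Lemma cyc_of_socle (E : icomplex R) i (J : set R) (B k : lmodType R)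
    (q : R^o -> B) (p : R^o -> k) s :
  is_ideal J -> idquot J q -> idquot m p ->
  (forall L, fg L -> ext0 E i.+1 L) ->
  ~ J s -> (forall x, m x -> J (x * s)) ->
  (forall s', (forall x, m x -> J (x * s')) -> @addm R R^o J s s') ->
  cyc E i k -> cyc E i B.
Proof.
move=> hJ qq qp van nJs ms us [tau [ctau htau]].
have [hq sq kq] := qq; have [hp sp kp] := qp.
have fgB : fg B := fg_surj hq sq (fg_R R).
have [f [hf injf fE]] := residue_embedding noethR locR hJ qq qp nJs ms.
have kf a : f a = 0 -> a = 0 by move=> fa; apply: injf; rewrite fa lin0.
have [|lam clam lamE] := coc_extend_van van hf fgB ctau.
  by move=> a /kf->; exact: lin0 ctau.1.
have [gens mE] := noethR (local_ideal locR).
have mgen (j : 'I_(size gens)) : m gens`_j.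
  by rewrite mE; apply: ideal_gen_sub; rewrite /= mem_nth.
pose V : lmodType R := 'I_(size gens) -> B.
have fgV : fg V.
  have := @fgset_pow R (size gens) B _ Logic.I fgB.
  by congr fgset; apply/seteqP.
pose h (v : B) : V := fun j => gens`_j *: v.
have hh : lin h.
  by move=> a u v; apply/funext => j; exact: (lin_scale gens`_j (@lin_id R B)) a u v.
pose inc (j : 'I_(size gens)) (v : B) : V := fun l => if l == j then v else 0.
have hinc j : lin (inc j).
  move=> a u v; apply/funext => l; rewrite /inc -[RHS]/(a *: _ + _).
  by case: ifP => _ //; rewrite scaler0 addr0.
have hE v : h v = \sum_(j < size gens) gens`_j *: inc j v.
  apply/funext => l; rewrite fct_sumZ (bigD1 l) //= /inc eqxx big1 ?addr0 //.
  by move=> j /negPf jl; rewrite eq_sym jl scaler0.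
(* the kernel of h is the socle *)
have kh v : h v = 0 -> exists a, f a = v.
  have [b <-] := sq v => hb.
  have [|t [u [Jt bE]]] := us b.
    move=> x; rewrite mE => /ideal_gen_seq[c ->]; rewrite mulr_suml.
    apply: (submod_sum (ideal_submod hJ)) => j; rewrite -mulrA.
    apply: (submodZ (ideal_submod hJ)); apply/kq.
    by have /(congr1 (fun w => w j)) := hb; rewrite /h -linZ.
  exists (p u); rewrite fE bE linD // (_ : q t = 0) ?add0r; last exact/kq.
  by congr q; exact: mulrC.
apply: (cyc_nakayama noethR locR fgB clam) => g cg.
have [a ca] := htau _ (coc_comp hf cg).
have [b cb bE] := cob_extend hf injf ca.
have cg1 : coc (fun v => g v - a *: lam v - b v).
  by apply: cocB (cob_coc cb); apply: cocB cg (cocZ a clam).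
have [|g3 cg3 g3E] := coc_extend_van van hh fgV cg1.
  by move=> v /kh[c <-]; rewrite bE lamE subrr.
exists a, 'I_(size gens), (fun j : 'I_(size gens) => gens`_j),
  (fun j v => g3 (inc j v)); split=> //.
  by move=> j; exact: coc_comp.
apply: cob_eq cb => v; symmetry.
have -> : \sum_(j < size gens) gens`_j *: g3 (inc j v) = g v - a *: lam v - b v.
  rewrite -g3E hE (lin_sum _ cg3.1); apply: eq_bigr => j _.
  by rewrite (linZ _ _ cg3.1).
by rewrite addrAC subKr.
Qed.

Section Canonical.
Variables (phi : {rmorphism R -> R}) (n : nat) (E : icomplex R).
Local Notation F M := (twist phi M : lmodType R).
Local Notation S := (F R^o).

Lemma regseq_twist M (K : set M) xs :
  regseq K [seq phi x | x <- xs] -> @regseq R (F M) K xs.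
Proof.
elim: xs K => //= x xs IHxs K [regx h]; split; first exact: regx.
exact: IHxs h.
Qed.

Variables (eta : R^o -> E 0%N).
Hypotheses (heta : lin eta) (injeta : injective eta).
Hypothesis keta : forall y, ic_d (i := 0) (y : E 0%N) = 0 <-> exists x, eta x = y.

Lemma resolution_ext0 : ~ ext0 E 0 (R^o : lmodType R).
Proof.
move=> /(_ eta) h; have /h eta0 : coc eta.
  by split=> // v; apply/keta; exists v.
by have /eqP := injeta (etrans (eta0 1) (esym (eta0 0))); rewrite oner_eq0.
Qed.

(** Hom(R, R) is generated by the identity. *)
Lemma resolution_cyc : cyc E 0 (R^o : lmodType R).
Proof.
have ceta : coc eta by split=> // v; apply/keta; exists v.
exists eta; split=> // g [hg dg]; have [a aE] := (keta _).1 (dg 1).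
exists a => v; apply/eqP; rewrite subr_eq0; apply/eqP.
have {1}-> : v = (v : R) *: (1 : R^o) by exact/esym/mulr1.
rewrite (linZ _ _ hg) -aE -!(linZ _ _ heta); congr eta; exact: mulrC.
Qed.

Hypotheses (n_gt0 : (0 < n)%N) (phiE : forall x, phi x = x ^+ n).
Hypothesis fgS : fg S.

Let phim a : m a -> m (phi a).
Proof.
rewrite phiE; case: n n_gt0 => // n' _ ma.
by rewrite exprSr; apply: (submodZ (ideal_submod (local_ideal locR))).
Qed.

Let E0 := resolution_ext0.

(** S is a maximal Cohen-Macaulay module: the sequence acts on S by the n-th
    powers of its members, which again form a regular sequence. *)
Lemma twist_ext0 i : ext0 E i.+1 S.
Proof.
have [xs maxxs] := max_regseq_exists noethR locR E0.
have [[regxs mxs] _] := maxxs.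
have regS : @regseq R S (@zero_set R S) xs.
  apply: regseq_twist; under eq_map => x do rewrite phiE.
  exact: regseq_exp n_gt0 (@zero_submod R R^o) regxs.
apply: (regseq_ext0_down (j := 1) noethR locR fgS (@zero_submod R S) regS mxs _
  (@zero_quot R S)) => // j.
by rewrite add1n => xj; exact: (max_regseq_van noethR locR maxxs xj).
Qed.

Local Notation E' := (coind_complex noethR fgS twist_ext0).

(** The cohomology of k over E' is that of F k over E, which consists of the
    multiples of [tau] by Hom(F k, k), itself cyclic over F k. *)
Lemma coind_residue_cyc i (k : lmodType R) (p : R^o -> k) : idquot m p ->
  cyc E i k -> cyc E' i k.
Proof.
move=> qp [tau [ctau htau]].
have [Phi hPhi PhiP] := residue_dual_cyclic noethR locR qp fgS phim.
have htP : @lin R (F k) (E i) (fun v => tau (Phi v)) := lin_comp ctau.1 hPhi.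
exists (coind_up htP : k -> E' i); split=> [|g cg].
  by apply: coind_coc_up => v; exact: ctau.2.
have [f hf cf] := residue_coc noethR locR qp (twist_residue_fg qp fgS)
  (twist_residue_kill locR qp phim) htau ctau.1 (coind_coc cg).
have [s sE] := PhiP f hf; exists s; apply: coind_cob.
  by apply: lin_sub cg.1 (lin_scale _ _); exact: coind_up_lin.
apply: cob_eq cf => v; rewrite sE.
by rewrite -[RHS]/(val (g v) 1 - tau (Phi ((1 * s) *: (v : k)))) mul1r.
Qed.

(** The cohomology over E' in degree 0 of R is Hom_R(S, R). It is cyclic
    because that of R/ys in the top degree is, and the latter is controlled by
    the socle of R/ys, which is a copy of the residue field. *)
Theorem frobenius_trace : exists2 Phi : S -> R^o, lin Phi &
  forall f : S -> R^o, lin f -> exists s : R, forall v : R, f v = Phi (s * v).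
Proof.
have [xs maxxs] := max_regseq_exists noethR locR E0.
pose ys := [seq x ^+ n | x <- xs].
have maxys : max_regseq m ys := max_regseq_exp locR n_gt0 maxxs.
have [[regys mys] _] := maxys.
have hJ := regseq_ideal_ideal ys.
have [s nJs ms] := max_regseq_socle noethR locR maxys.
have [k [p qp]] := quotient_exists (ideal_submod (local_ideal locR)).
have van' i : (size ys < i)%N -> forall N, fg N -> ext0 E' i N.
  move=> yi N fgN; apply: coind_ext0.
  exact: (max_regseq_van noethR locR maxys yi (fg_twist fgS fgN)).
have [lam [clam hlam]] : cyc E' 0 (R^o : lmodType R).
  apply: (regseq_cyc_down (m := m) (j := 0) noethR locR (fg_R R) (@zero_submod R R^o)
    regys mys _ (@zero_quot R R^o)) => [B q qq|[//|i] _]; last exact: ext0_R.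
  apply: (cyc_of_socle hJ qq qp (van' _ (ltnSn _)) nJs ms).
    move=> s' ms'.
    exact: (socle_unique noethR locR E0 maxys resolution_cyc qq qp nJs ms ms').
  apply: (coind_residue_cyc qp).
  exact: (residue_cyc noethR locR maxys resolution_cyc qq qp).
have lift_eta (f : S -> E 0%N) : lin f -> (forall v, ic_d (f v) = 0) ->
    exists2 h : S -> R^o, lin h & forall v, eta (h v) = f v.
  move=> hf df; pose h v := projT1 (cid ((keta _).1 (df v))).
  have hE v : eta (h v) = f v by rewrite /h; case: cid.
  exists h => // a x y; apply: injeta; rewrite hE hf -!hE (linD _ _ heta).
  by rewrite (linZ _ _ heta).
have [|Phi hPhi PhiE] := lift_eta (val (lam 1)) (coind_lin (lam 1)).
  by move=> v; rewrite -[LHS]/(val (ic_d (lam 1 : E' 0%N)) v) clam.2.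
exists Phi => // f hf.
have hef : @lin R S (E 0%N) (fun v => eta (f v)) := lin_comp heta hf.
have [|a ca] := hlam (fun r : R^o => (r : R) *: (coind_of hef : E' 0%N)).
  split=> [b x y|v]; first by rewrite scalerDl scalerA.
  apply: coind_ext => t; rewrite -[LHS]/(ic_d (eta (f (t * v)))).
  by apply/keta; eexists.
exists a => v; apply: injeta; rewrite PhiE mulrC.
have := congr1 (fun f : coind phi (E 0%N) => coind_fun f v) (ca 1).
rewrite /= => /eqP; rewrite -[X in X == _]/(eta (f (v * 1)) - val (lam 1) (v * a)).
by rewrite subr_eq0 mulr1 => /eqP.
Qed.

End Canonical.
End Cyclic.

(** * Modules of finite projective dimension *)

Section FreeModule.
Variables (R : comNzRingType) (P : lmodType R).
Local Open Scope fset_scope.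

Definition free_sum (g : {malg R[P]}) : P := \sum_(x <- msupp g) g@_x *: x.

(** Sums over a common support make [free_sum] visibly linear. *)
Lemma free_sumE (g : {malg R[P]}) (D : {fset P}) :
  (msupp g `<=` D)%fset -> free_sum g = \sum_(x <- D) g@_x *: x.
Proof.
move=> gD; apply: big_fset_incl => // x _ /mcoeff_outdom->.
by rewrite scale0r.
Qed.

Lemma free_sum_lin : lin free_sum.
Proof.
move=> a f g.
have sub1 : (msupp f `<=` msupp f `|` msupp g)%fset by exact: fsubsetUl.
have sub2 : (msupp g `<=` msupp f `|` msupp g)%fset by exact: fsubsetUr.
have sub3 : (msupp (a *: f + g)%R `<=` msupp f `|` msupp g)%fset.
  apply: fsubset_trans (msuppD_le _ _) _.
  by apply: fsetSU; exact: msuppZ_le.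
rewrite (free_sumE sub1) (free_sumE sub2) (free_sumE sub3) scaler_sumr -big_split.
by apply: eq_bigr => x _; rewrite mcoeffD mcoeffZ scalerDl scalerA.
Qed.

Lemma free_sumU x : free_sum << x >> = x.
Proof. by rewrite (free_sumE msuppU_le) big_seq_fset1 mcoeffUU scale1r. Qed.

End FreeModule.

Section FiniteProjectiveDimension.
Variables (R : comNzRingType) (E : icomplex R).
Hypothesis noethR : noetherian R.
Variable eta : R^o -> E 0%N.
Hypotheses (heta : lin eta) (injeta : injective eta).
Hypothesis keta : forall y : E 0%N, ic_d y = 0 <-> exists x, eta x = y.
Implicit Types F K L M N P : lmodType R.

(** For R Gorenstein these are zero and the maximal Cohen-Macaulay modules. *)
Definition ext_acyclic M := fg M /\ forall i, ext0 E i.+1 M.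

Lemma syzygy M : ext_acyclic M -> exists n (p : 'rV[R]_n -> M) K (k : K -> 'rV[R]_n),
  [/\ lin p, forall y, exists x, p x = y, lin k, injective k &
      (forall v, p v = 0 <-> exists y, k y = v) /\ ext_acyclic K].
Proof.
move=> [fgM extM]; have [n [p [hp sp]]] := fg_cover fgM.
have [K [k [hk injk kp]]] := kernel_exists hp.
exists n, p, K, k; split=> //; split=> //; split.
  exact: (noeth_fg_inj noethR hk injk (fg_rV R n)).
move=> i; apply: (ext0_left hk injk (is_quot_ker hp sp kp)); first exact: ext0_rV.
exact: extM.
Qed.

(** The extension to F of a map on the syzygy K is obstructed by Ext^1(M, R). *)
Lemma extend_to_R K F M (k : K -> F) (p : F -> M) (f : K -> R^o) :
  lin k -> injective k -> lin p -> (forall y, exists x, p x = y) ->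
  (forall v, p v = 0 <-> exists y, k y = v) -> ext0 E 1 M -> lin f ->
  exists2 h : F -> R^o, lin h & forall v, h (k v) = f v.
Proof.
move=> hk injk hp sp kp extM hf.
have cef : coc (fun v => eta (f v)).
  by split=> [|v]; [exact: lin_comp | apply/keta; eexists].
have [|g [hg dg] gE] := coc_extend hk (is_quot_ker hp sp kp) extM cef.
  by move=> a ka; rewrite (_ : a = 0) ?(lin0 hf) ?(lin0 heta) //; apply: injk; rewrite ka lin0.
pose h v := projT1 (cid ((keta _).1 (dg v))).
have hE v : eta (h v) = g v by rewrite /h; case: cid.
exists h => [a x y|v]; apply: injeta; last by rewrite hE gE.
by rewrite hE hg -!hE (linD _ _ heta) (linZ _ _ heta).
Qed.

(** A projective module is a summand of a free one, and a map from a finitely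
    generated module into a free one has only finitely many coordinates. *)
Lemma extend_to_projective K F M P (k : K -> F) (p : F -> M) (f : K -> P) :
  lin k -> injective k -> lin p -> (forall y, exists x, p x = y) ->
  (forall v, p v = 0 <-> exists y, k y = v) -> ext0 E 1 M -> fg K ->
  projective_module P -> lin f ->
  exists2 h : F -> P, lin h & forall v, h (k v) = f v.
Proof.
move=> hk injk hp sp kp extM [I [g [_ gK]]] projP hf.
have [sum sumE] := lin_linear (@free_sum_lin R P).
have [idP idPE] := lin_linear (@lin_id R P).
have [|s sP] := projP _ _ sum idP.
  by move=> x; exists << x >>; rewrite sumE free_sumU.
have hsf : lin (fun v => s (f v)) by exact: lin_comp (linear_lin s) hf.
pose D : {fset P} := (\bigcup_(i <- enum I) msupp (s (f (g i))))%fset.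
have suppD v : (msupp (s (f v)) `<=` D)%fset.
  have [//|c ->] := gK v; rewrite (lin_sum _ hsf).
  apply/fsubsetP => x; rewrite -mcoeff_neq0 raddf_sum /= => /eqP.
  apply: contra_notT => xD; apply: big1 => i _.
  rewrite (linZ _ _ hsf) mcoeffZ mcoeff_outdom ?mulr0 //.
  by apply: contra xD => xi; apply/bigfcupP; exists i; rewrite ?mem_enum.
have hcoef x : @lin R K R^o (fun v => (s (f v))@_x).
  by move=> a u v; rewrite hsf mcoeffD mcoeffZ.
pose c x := s2val (cid2 (extend_to_R hk injk hp sp kp extM (hcoef x))).
have hc x : lin (c x) by exact: s2valP (cid2 (extend_to_R _ _ _ _ _ _ _)).
have cE x v : c x (k v) = (s (f v))@_x.
  exact: (s2valP' (cid2 (extend_to_R hk injk hp sp kp extM (hcoef x))) v).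
exists (fun v => \sum_(x <- D) (c x v : R) *: x) => [a u v|v].
  rewrite scaler_sumr -big_split; apply: eq_bigr => x _.
  by rewrite (hc x) scalerDl scalerA.
under eq_bigr => x _ do rewrite cE.
by rewrite -(free_sumE (suppD v)) -sumE sP idPE.
Qed.

(** Lift on a free cover of [M]; the values on the syzygy come from P2, and the
    map to P2 that provides them extends to the free cover. *)
Lemma lift_step M P0 P1 P2 (t : P1 -> P0) (u : P2 -> P1) (f : M -> P0) :
  ext_acyclic M -> lin t -> lin u -> (forall y, t (u y) = 0) ->
  projective_module P2 ->
  (forall K (h : K -> P1), ext_acyclic K -> lin h -> (forall v, t (h v) = 0) ->
     exists2 g : K -> P2, lin g & forall v, u (g v) = h v) ->
  lin f -> (forall v, exists y, t y = f v) ->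
  exists2 g : M -> P1, lin g & forall v, t (g v) = f v.
Proof.
move=> acM ht hu tu projP2 liftK hf tf.
have [n [p [K [k [hp sp hk injk [kp acK]]]]]] := syzygy acM.
have pk y : p (k y) = 0 by apply/kp; exists y.
have [|h hh hE] := rV_lift ht (lin_comp hf hp); first by move=> v; exact: tf.
have [||g hg gE] := liftK K (fun y => h (k y)) acK.
- exact: lin_comp.
- by move=> y; rewrite hE pk lin0.
have [g' hg' g'E] := extend_to_projective hk injk hp sp kp (acM.2 0%N) acK.1 projP2 hg.
have [||w hw wE] := @quot_factor _ _ _ _ p (fun v => h v - u (g' v)) hp sp.
- exact: lin_sub hh (lin_comp hu hg').
- by move=> v /kp[y <-]; rewrite g'E gE subrr.
exists w => // v; have [y <-] := sp v.
by rewrite wE (linB _ _ ht) hE tu subr0.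
Qed.

(** Descending induction from the end of the resolution, each step trading [M]
    for its syzygy. *)
Lemma lift_resolution N n (P : nat -> lmodType R) (eps : {linear P 0%N -> N})
    (d : forall i, {linear P i.+1 -> P i}) :
  (forall x, exists y, eps y = x) -> exact_at (d 0%N) eps ->
  (forall i, exact_at (d i.+1) (d i)) -> (forall i, projective_module (P i)) ->
  (forall i, (n < i)%N -> forall x : P i, x = 0) ->
  forall M, ext_acyclic M ->
    (forall f : M -> N, lin f ->
       exists2 g : M -> P 0%N, lin g & forall v, eps (g v) = f v) /\
    (forall f : M -> P 0%N, lin f -> (forall v, eps (f v) = 0) ->
       exists2 g : M -> P 1%N, lin g & forall v, d 0%N (g v) = f v).
Proof.
move=> seps ex0 ex projP P0 M acM.
have dd i y : d i (d i.+1 y) = 0 by apply/ex; exists y.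
have step j i : (n < i + j)%N -> forall M (f : M -> P i), ext_acyclic M ->
    lin f -> (forall v, exists y, d i y = f v) ->
    exists2 g : M -> P i.+1, lin g & forall v, d i (g v) = f v.
  elim: j i => [|j IHj] i nij L f acL hf df.
    exists (fun=> 0) => [|v]; first exact: lin_cst0.
    by rewrite addn0 in nij; rewrite linear0 [f v](P0 i nij).
  apply: (lift_step acL (linear_lin (d i)) (linear_lin (d i.+1)) (dd i) (projP _) _ hf df).
  move=> K h acK hh dh; apply: (IHj i.+1) => //; first by rewrite addSnnS.
  by move=> v; apply/ex.
have step0 (L : lmodType R) (f : L -> P 0%N) : ext_acyclic L -> lin f ->
    (forall v, eps (f v) = 0) ->
    exists2 g : L -> P 1%N, lin g & forall v, d 0%N (g v) = f v.
  move=> acL hf ef; apply: (step n.+1 0%N) => // v; exact/ex0.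
split=> [f hf|f]; last exact: step0.
apply: (lift_step acM (linear_lin eps) (linear_lin (d 0%N)) _ (projP _) _ hf) => //.
by move=> y; apply/ex0; exists y.
Qed.

(** Maps [al] and [be] over R/Q in both directions between P_0 and R transport
    the exactness of Hom(M, P) to R. For the second part, [al \o be] is
    multiplication by some [c] with 1 - c in Q, and f = (1 - c) f + al (be f)
    where [be \o f] lifts to P_1. *)
Theorem lift_quotient (Q : set R) N (pi : R^o -> N) M :
  is_ideal Q -> @is_quot R R^o N Q pi -> finite_proj_dim N -> ext_acyclic M ->
  (forall f : M -> N, lin f ->
     exists2 g : M -> R^o, lin g & forall v, pi (g v) = f v) /\
  (forall f : M -> R^o, lin f -> (forall v, Q (f v)) ->
     exists n (q : 'I_n -> R) (h : 'I_n -> M -> R^o),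
       [/\ forall i, Q (q i), forall i, lin (h i) &
           forall v, f v = \sum_i q i * h i v]).
Proof.
move=> hQ [hpi spi kpi] [n [P [eps [d [seps ex0 ex projP P0]]]]] acM.
have [lift0 lift1] := lift_resolution seps ex0 ex projP P0 acM.
have [pil pilE] := lin_linear hpi.
have [|al alP] := projP 0%N _ _ pil eps.
  by move=> y; have [x <-] := spi y; exists x.
have {}alP x : pi (al x) = eps x by rewrite -pilE alP.
split=> f hf.
  have [g hg gE] := lift0 f hf; exists (fun v => al (g v)).
    exact: lin_comp (linear_lin al) hg.
  by move=> v; rewrite alP gE.
move=> Qf.
have [|be hbe beE] := R_lift (linear_lin eps) hpi; first by move=> v; exact: seps.
have [||g hg gE] := lift1 (fun v => be (f v)).
- exact: lin_comp.
- by move=> v; rewrite beE; apply/kpi.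
pose c : R := al (be 1).
have Qc : Q (1 - c) by apply/kpi; rewrite (linB _ _ hpi) alP beE subrr.
have [s QE] := noethR hQ.
have Qs (i : 'I_(size s)) : Q s`_i.
  by rewrite QE; apply: ideal_gen_sub; rewrite /= mem_nth.
have [QT [io [hio injio ioP]]] := @submodule_exists R R^o Q hQ.
(* [al \o d 0] maps P_1 to Q, hence lifts along generators of Q *)
pose ka (v : 'rV[R]_(size s)) : R^o := \sum_i v 0 i *: (s`_i : R^o).
have hka : lin ka by exact: rV_map.
have Qka v : Q (ka v).
  by apply: (submod_sum (ideal_submod hQ)) => i; exact: (submodZ (ideal_submod hQ)).
have Qal y : Q (al (d 0%N y)).
  by apply/kpi; rewrite alP; apply/ex0; exists y.
have into L (t : L -> R^o) : lin t -> (forall v, Q (t v)) ->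
    exists t' : {linear L -> QT}, forall v, io (t' v) = t v.
  move=> ht Qt; pose t' v := projT1 (cid ((ioP _).1 (Qt v))).
  have t'E v : io (t' v) = t v by rewrite /t'; case: cid.
  have [|t2 t2E] := @lin_linear _ _ _ t'.
    move=> a x y; apply: injio; rewrite t'E ht -!t'E (linD _ _ hio).
    by rewrite (linZ _ _ hio).
  by exists t2 => v; rewrite t2E t'E.
have [ka' ka'E] := into _ ka hka Qka.
have [|th thE] := into _ (fun y => al (d 0%N y)) _ Qal.
  exact: lin_comp (linear_lin al) (linear_lin (d 0%N)).
have [|ga gaE] := projP 1%N _ _ ka' th.
  move=> y; have [|b bE] := @ideal_gen_seq _ s (io y).
    by rewrite -QE; apply/ioP; exists y.
  exists (\row_i b i); apply: injio; rewrite ka'E bE.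
  by apply: eq_bigr => i _; rewrite mxE.
exists (size s).+1, (fun i => if unlift ord0 i is Some j then s`_j else 1 - c),
  (fun i v => if unlift ord0 i is Some j then ga (g v) 0 j else f v).
split=> [i|i|v].
- by case: unliftP.
- case: unliftP => [j _|_] //.
  by move=> a x y; rewrite hg linearP !mxE.
rewrite big_ord_recl unlift_none.
under eq_bigr => i _ do rewrite liftK mulrC.
rewrite -[\sum_i _]/(ka (ga (g v))) -ka'E gaE thE gE.
rewrite (_ : be (f v) = (f v : R) *: be 1).
  rewrite linearZ -[X in _ + X]/((f v : R) * c) mulrBl mul1r.
  by rewrite [c * _]mulrC subrK.
by rewrite -(linZ _ _ hbe); congr be; exact/esym/mulr1.
Qed.

End FiniteProjectiveDimension.

(** * Frobenius *)

Section Frobenius.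
Variables (R : comNzRingType) (p : nat) (charRp : p \in [pchar R]).

Lemma frobD e : {morph (fun x : R => x ^+ (p ^ e)) : x y / x + y}.
Proof.
move=> x y; apply: exprDn_pchar.
by rewrite pnatX orbC (pnatE _ (pcharf_prime charRp)) charRp orbT.
Qed.

Definition frob of p \in [pchar R] := fun (e : nat) (x : R) => x ^+ (p ^ e).

Lemma frob_is_zmod_morphism e : zmod_morphism (frob charRp e).
Proof.
move=> x y; apply: (addIr (frob charRp e y)).
by rewrite -[LHS](frobD e (x - y) y) !subrK.
Qed.

Lemma frob_is_monoid_morphism e : monoid_morphism (frob charRp e).
Proof. by split=> [|x y]; [exact: expr1n | exact: exprMn]. Qed.

HB.instance Definition _ e :=
  GRing.isZmodMorphism.Build R R (frob charRp e) (frob_is_zmod_morphism e).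
HB.instance Definition _ e :=
  GRing.isMonoidMorphism.Build R R (frob charRp e) (frob_is_monoid_morphism e).

Lemma frob_sum e (I : finType) (F : I -> R) :
  (\sum_i F i) ^+ (p ^ e) = \sum_i F i ^+ (p ^ e).
Proof. exact: (rmorph_sum (frob charRp e)). Qed.

Local Notation S e := (twist (frob charRp e) R^o : lmodType R).

(** R is finite over the image of one Frobenius if it is over that of an
    iterate, and finiteness is transitive. *)
Lemma frob_fg e : F_finite charRp -> fg (S e).
Proof.
pose fin e := exists (I : finType) (g : I -> R),
  forall x, exists c : I -> R, x = \sum_i c i ^+ (p ^ e) * g i.
move=> finR; suff [I [g gP]] : fin e.
  by exists I, g; split=> // x _; have [c ->] := gP x; exists c.
case: finR => -[//|e'] _ [n [g gP]].
have [I1 [h hP]] : fin 1%N.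
  exists 'I_n, g => x; have [c ->] := gP x.
  exists (fun i => c i ^+ (p ^ e')) => //; apply: eq_bigr => i _.
  by rewrite expn1 -exprM -expnSr.
elim: e => [|e [I [k kP]]].
  by exists 'I_1, (fun=> 1) => x; exists (fun=> x); rewrite big_ord1 mulr1 expr1.
exists (I * I1)%type, (fun ij => h ij.2 ^+ (p ^ e) * k ij.1) => x.
have [c ->] := kP x.
pose b i := projT1 (cid (hP (c i))).
have bE i : c i = \sum_j b i j ^+ (p ^ 1) * h j by rewrite /b; case: cid.
exists (fun ij => b ij.1 ij.2).
rewrite -(pair_bigA _ (fun i j => b i j ^+ (p ^ e.+1) * (h j ^+ (p ^ e) * k i))) /=.
apply: eq_bigr => i _; rewrite {1}bE frob_sum mulr_suml; apply: eq_bigr => j _.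
by rewrite exprMn -exprM expn1 -expnS mulrA.
Qed.

(** A splitting of one iterate of Frobenius restricts to one of Frobenius, and
    composing that with itself splits all iterates. *)
Lemma F_pure_splitting e : F_pure charRp ->
  exists f : R -> R, [/\ forall x y, f (x + y) = f x + f y,
    forall a x, f (a ^+ (p ^ e) * x) = a * f x & f 1 = 1].
Proof.
case=> -[//|e'] _ [phi phiE].
have phiD x y : phi (x + y) = phi x + phi y by exact: linearD.
have phiZ a x : phi (a ^+ (p ^ e'.+1) * x) = a * phi x.
  exact: (@linZ R (Fpush charRp e'.+1) R^o phi a x (linear_lin phi)).
elim: e => [|e [f [fD fZ f1]]].
  by exists id; split=> // a x; rewrite expn0 expr1.
exists (fun x => phi (f x ^+ (p ^ e'))); split.
- by move=> x y; rewrite fD frobD phiD.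
- by move=> a x; rewrite expnS exprM fZ exprMn -exprM -expnS phiZ.
- by rewrite f1 expr1n; have := phiE 1; rewrite /Fmap expr1n.
Qed.

End Frobenius.

Section Quotient.
Variables (R : comNzRingType) (Q : idealr R).

Lemma idealr_is_ideal : is_ideal [set` Q].
Proof.
split=> [|a x y Qx Qy]; first exact: rpred0.
by apply: rpredD => //; exact: idealMr.
Qed.

Definition qpi (x : R^o) : {ideal_quot Q} := \pi_{ideal_quot Q} x.

Lemma qpi_quot : @is_quot R R^o {ideal_quot Q} [set` Q] qpi.
Proof.
split.
- by move=> a x y; rewrite /qpi rmorphD; congr (_ + _); exact: rmorphM.
- by move=> y; exists (repr y); exact: reprK.
- move=> x; have q0 : qpi 0 = 0 by exact: rmorph0.
  rewrite -q0 -[X in [set` Q] X]subr0 /= Quotient.idealrBE.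
  by split=> /eqP.
Qed.

End Quotient.

(** * The criterion *)

Section Criterion.
Variables (R : comNzRingType) (p : nat) (charRp : p \in [pchar R]).
Variables (m : set R) (Q : idealr R) (e : nat).
Hypotheses (noethR : noetherian R) (locR : local_ring m).
Local Notation N := ({ideal_quot Q} : lmodType R).
Local Notation q := (p ^ e)%N.

Let hm := ideal_submod (local_ideal locR).
Let hQ := ideal_submod (idealr_is_ideal Q).

Lemma idealr_local x : x \in Q -> m x.
Proof.
apply: (proper_sub_local noethR locR (idealr_is_ideal Q)).
by rewrite /= idealr1.
Qed.

Lemma frob_power_sub_I : frob_power p e [set` Q] `<=` I_ charRp e [set` Q].
Proof.
apply: ideal_gen_min => [|_ [x Qx <-] phi].
  split=> [phi|a x y Ix Iy phi].
    by rewrite linear0; exact: hQ.1.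
  have hf : @lin R (Fpush charRp e) (Fpush charRp e)
      (fun s => Felt charRp e (a * (s : R))).
    move=> c u v; rewrite /Felt -[c *: u + v]/(c ^+ q * (u : R) + (v : R)).
    by rewrite mulrDr mulrCA.
  have [psi psiE] := lin_linear (lin_comp (linear_lin phi) hf).
  rewrite -[Felt _ _ _]/(Felt charRp e (a * x) + Felt charRp e y) linearD.
  apply: (submodD hQ); last exact: Iy.
  by rewrite -[phi _]/(phi (Felt charRp e (a * x))) -psiE; exact: Ix.
rewrite (_ : Felt _ _ _ = x *: Felt charRp e 1); last first.
  by rewrite -[RHS]/(Felt charRp e (x ^+ q * 1)) mulr1.
rewrite linearZ; have : phi (Felt charRp e 1) * x \in Q by exact: idealMr.
by rewrite mulrC.
Qed.

(** The map phi(r * _), divided by its value at 1, preserves Q. *)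
Lemma F_pure_of_colon : (0 < e)%N ->
  ~ (colon (I_ charRp e [set` Q]) [set` Q] `<=` I_ charRp e m) ->
  F_pure (pchar_quot Q charRp).
Proof.
move=> e_gt0 nsub.
have [r [Ir [phi nm]]] : exists r, colon (I_ charRp e [set` Q]) [set` Q] r /\
    exists phi : {linear Fpush charRp e -> R^o}, ~ m (phi (Felt charRp e r)).
  apply: contrapT => no; apply: nsub => r Ir phi; apply: contrapT => nm.
  by apply: no; exists r; split=> //; exists phi.
have [u ur] := local_unit noethR locR nm.
exists e => //.
pose psi (s : R) : R := u * phi (Felt charRp e (r * s)).
have psiD s t : psi (s + t) = psi s + psi t.
  rewrite /psi -[RHS]mulrDr -linearD; congr (u * phi _); exact: mulrDr.
have psiZ a s : psi (a ^+ q * s) = a * psi s.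
  rewrite /psi mulrCA [RHS]mulrCA; congr (_ * _).
  exact: (@linZ R (Fpush charRp e) R^o phi a (r * s) (linear_lin phi)).
have psi1 : psi 1 = 1 by rewrite /psi mulr1.
have psiQ s : s \in Q -> psi s \in Q.
  by move=> Qs; apply: idealMr; exact: Ir.
have [hpi spi kpi] := qpi_quot Q.
pose f (x : {ideal_quot Q}) : {ideal_quot Q} := qpi Q (psi (repr x)).
have fE s : f (qpi Q s) = qpi Q (psi s).
  apply/eqP; rewrite -subr_eq0 -(linB _ _ hpi); apply/eqP/kpi => /=.
  have -> : psi (repr (qpi Q s)) - psi s = psi (repr (qpi Q s) - s).
    by apply: (addIr (psi s)); rewrite -psiD !subrK.
  apply: psiQ; apply/kpi; rewrite (linB _ _ hpi) {1}/qpi reprK.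
  exact: subrr.
have piX (s : R) k : (qpi Q s) ^+ k = qpi Q (s ^+ k) by rewrite /qpi rmorphXn.
have piM (s t : R) : qpi Q s * qpi Q t = qpi Q (s * t) by rewrite /qpi rmorphM.
have hf : @lin _ (Fpush (pchar_quot Q charRp) e) {ideal_quot Q}^o f.
  move=> a x y; have [a' <-] := spi a; have [x' <-] := spi x; have [y' <-] := spi y.
  rewrite -[X in f X]/(qpi Q a' ^+ q * qpi Q x' + qpi Q y') piX piM.
  rewrite -(linD _ _ hpi) !fE psiD psiZ (linD _ _ hpi) -piM.
  by [].
have [F FE] := lin_linear hf; exists F => a; rewrite FE.
have [a' <-] := spi a.
by rewrite -[X in f X]/(qpi Q a' ^+ q) piX fE -[a' ^+ q]mulr1 psiZ psi1 mulr1.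
Qed.

Lemma gorenstein_resolution : gorenstein R ->
  exists (E : icomplex R) (eta : R^o -> E 0%N), [/\ lin eta, injective eta &
    forall y : E 0%N, ic_d y = 0 <-> exists x, eta x = y].
Proof.
case=> n [E [eta [d [injeta ex0 ex injE E0]]]].
unshelve eexists (@ICx R E (fun i => d i) _ _ _ _ _ _).
- by move=> i; exact: linear_lin.
- by move=> i x; apply/ex; exists x.
- exact: injE.
- by move=> i y /ex.
- by exists n.
- exists 'I_1, (fun=> eta 1); split=> [_|y /ex0[x <-]]; first by apply/ex0; exists 1.
  exists (fun=> x); rewrite big_ord1 -linearZ; congr (eta _); exact/esym/mulr1.
exists eta; split=> //; exact: linear_lin.
Qed.

(** A splitting of Frobenius on R/Q lifts to [psi : F_* R -> R]; it is a
    multiple [Phi (r * _)] of the trace generator, and [r] is the element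
    required. The trace generator has no annihilator because [psi t^q] is
    [t * psi 1]. *)
Lemma colon_of_F_pure : F_finite charRp -> gorenstein R ->
  finite_proj_dim {ideal_quot Q} -> F_pure (pchar_quot Q charRp) ->
  ~ (colon (frob_power p e [set` Q]) [set` Q] `<=` I_ charRp e m).
Proof.
move=> finR /gorenstein_resolution[E [eta [heta injeta keta]]] fpdQ pureQ sub.
have p_gt0 : (0 < p)%N by rewrite prime_gt0 ?(pcharf_prime charRp).
have q_gt0 : (0 < q)%N by rewrite expn_gt0 p_gt0.
pose phi : {rmorphism R -> R} := frob charRp e.
pose S : lmodType R := twist phi R^o.
have phiE x : phi x = x ^+ q by [].
have fgS : fg S := frob_fg e finR.
have [Phi hPhi PhiP] := frobenius_trace noethR locR heta injeta keta q_gt0 phiE fgS.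
have acS : ext_acyclic E S.
  split=> // i; exact: (twist_ext0 noethR locR heta injeta keta q_gt0 phiE fgS).
have [lift liftQ] := lift_quotient noethR heta injeta keta (idealr_is_ideal Q)
  (qpi_quot Q) fpdQ acS.
have [hpi spi kpi] := qpi_quot Q.
have [f [fD fZ f1]] := F_pure_splitting e pureQ.
have [|psi hpsi psiE] := lift (fun s : R => f (qpi Q s)).
  move=> a x y; rewrite -[X in qpi Q X]/(a ^+ q * (x : R) + (y : R)).
  by rewrite (linD _ _ hpi) fD /qpi rmorphM rmorphXn fZ.
have psiQ s : s \in Q -> psi s \in Q.
  move=> /kpi Qs; apply/kpi; rewrite psiE Qs.
  by apply: (addIr (f 0)); rewrite -fD !add0r.
have psiD x y : psi (x + y) = psi x + psi y by exact: (linD _ _ hpsi).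
have psiZ a x : psi (a ^+ q * x) = a * psi x.
  exact: (@linZ R S R^o psi a x hpsi).
have Qpsi1 : (psi 1 : R) - 1 \in Q.
  apply/kpi; rewrite (linB _ _ hpi) psiE.
  by rewrite (_ : qpi Q 1 = 1) ?f1 ?subrr //; exact: rmorph1.
have nm1 : ~ m (psi 1).
  move=> m1; apply: (local_n1 locR).
  rewrite -[1](subKr (psi 1 : R)); apply: (submodB hm) => //.
  exact: idealr_local.
have [u u1] := local_unit noethR locR nm1.
have [r rE] := PhiP psi hpsi.
have Phi0 t : (forall s : R, Phi (t * s) = 0) -> t = 0.
  move=> Pt; have : psi (t ^+ q * 1) = 0.
    rewrite rE -(prednK q_gt0) exprS -mulrA.
    by rewrite [r * _]mulrCA; exact: Pt.
  rewrite psiZ => /(congr1 ( *%R u)); rewrite mulrCA u1 mulr1 mulr0.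
  by [].
have rcolon : colon (frob_power p e [set` Q]) [set` Q] r.
  move=> x /= Qx.
  have hx : @lin R S R^o (fun s => psi (x * (s : R))).
    exact: lin_comp hpsi (twist_mul_lin (phi := phi) x).
  have [|n [z [h [Qz hh hE]]]] := liftQ _ hx.
    by move=> s; apply: psiQ; rewrite mulrC; exact: idealMr.
  have t_ex i := PhiP (h i) (hh i).
  pose t i := projT1 (cid (t_ex i)).
  have tE i v : h i v = Phi (t i * v) by rewrite /t; case: cid.
  suff -> : r * x = \sum_i z i ^+ q * t i.
    have hF : @submod R R^o (frob_power p e [set` Q]) := ideal_submod (ideal_gen_ideal _).
    apply: (submod_sum hF) => i; rewrite mulrC; apply: (submodZ hF).
    by apply: ideal_gen_sub; exists (z i) => //; exact: Qz.
  apply/eqP; rewrite -subr_eq0; apply/eqP/Phi0 => s.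
  rewrite mulrBl (linB _ _ hPhi) -mulrA -rE hE mulr_suml (lin_sum _ hPhi).
  apply/eqP; rewrite subr_eq0; apply/eqP; apply: eq_bigr => i _.
  rewrite tE -mulrA; apply: esym.
  exact: (@linZ R S R^o Phi (z i) (t i * s) hPhi).
have [Phil PhilE] := @lin_linear R (Fpush charRp e) R^o Phi hPhi.
have := sub r rcolon Phil; rewrite PhilE => mr; apply: nm1.
by rewrite rE mulr1.
Qed.

End Criterion.

Theorem corollary3p4 (R : comNzRingType) (p : nat) (charRp : p \in [pchar R])
    (m : set R) (Q : idealr R) (e : nat) :
  noetherian R -> local_ring m -> F_finite charRp -> gorenstein R ->
  (0 < e)%N ->
  let cond1 :=
    ~ (colon (frob_power p e [set` Q]) [set` Q] `<=` I_ charRp e m) in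
  let cond2 :=
    ~ (colon (I_ charRp e [set` Q]) [set` Q] `<=` I_ charRp e m) in
  let cond3 := F_pure (pchar_quot Q charRp) in
  [/\ cond1 -> cond2,
      cond2 -> cond3 &
      finite_proj_dim {ideal_quot Q} -> cond3 -> cond1].
Proof.
move=> noethR locR finR gorR e_gt0 cond1 cond2 cond3; split.
- move=> c1 sub; apply: c1 => r hr; apply: sub => x Qx.
  by apply: frob_power_sub_I; exact: hr.
- exact: F_pure_of_colon.
- exact: colon_of_F_pure.
Qed.
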